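(* Let $Y$ be a flat manifold and let $g:Y\to Y$ be an expanding endomorphism. Then the odometer action of $\pi_1(Y)$ on $\Omega$ associated to $g$ is free.
   Context: A flat manifold is a closed, connected Riemannian manifold (of positive dimension) whose metric is flat. A $C^1$ map $g:Y\to Y$ is an expanding endomorphism if, for a Riemannian metric on $Y$, there are $C>0$ and $\lambda>1$ with $\|Tg^k v\|\ge C\lambda^k\|v\|$ for all $v\in TY$ and all integers $k\ge1$. By results of Shub, $g$ is an $n$-fold covering map for some $n\ge2$ and has a fixed point $y_0$; put $\pi_1(Y)=\pi_1(Y,y_0)$ and let $g_*$ be the induced injective endomorphism of $\pi_1(Y)$. Odometer: let $\Omega_i=\pi_1(Y)/g_*^i(\pi_1(Y))$ (left cosets, a finite set; the subgroup need not be normal), let $\Omega_{i}\to\Omega_{i-1}$ be the map induced by inclusion of cosets, and let $\Omega=\varprojlim\Omega_i$ with the inverse limit topology. The odometer action of $\pi_1(Y)$ on $\Omega$ is $\gamma\cdot(\gamma_i g_*^i(\pi_1(Y)))_{i\ge0}=(\gamma\gamma_i g_*^i(\pi_1(Y)))_{i\ge0}$. An action is free if no non-identity group element fixes any point. *)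

(* Defs.v *)
From HB Require Import structures.
From mathcomp Require Import all_boot all_order all_algebra.
From mathcomp Require Import generic_quotient.
From mathcomp Require Import all_classical all_reals all_analysis.
From mathcomp Require Import lra.

Set Implicit Arguments.
Unset Strict Implicit.
Unset Printing Implicit Defensive.

Import Order.TTheory GRing.Theory Num.Theory.
Import numFieldNormedType.Exports.

Local Open Scope classical_set_scope.
Local Open Scope ring_scope.
Local Open Scope quotient_scope.

Fixpoint Ck (R : realType) (V W : normedModType R) (k : nat) (U : set V)
    (f : V -> W) : Prop :=
  match k with
  | 0 => forall x, U x -> {for x, continuous f}
  | k'.+1 => (forall x, U x -> differentiable f x) /\
             forall v, Ck k' U ('D_v f)
  end.

Definition smooth (R : realType) (V W : normedModType R) (U : set V)
  (f : V -> W) : Prop := forall k, Ck k U f.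

Record chart (R : realType) (n : nat) (Y : topologicalType) := Chart {
  dom : set Y ;
  coord : Y -> 'rV[R]_n ;
  param : 'rV[R]_n -> Y ;
  dom_open : open dom ;
  cod_open : open (coord @` dom) ;
  coord_continuous : {within dom, continuous coord} ;
  param_continuous : {within coord @` dom, continuous param} ;
  coordK : {in dom, cancel coord param}
}.

Definition transition (R : realType) (n : nat) (Y : topologicalType)
  (c d : chart R n Y) : 'rV[R]_n -> 'rV[R]_n := coord d \o param c.

Record smooth_structure (R : realType) (n : nat) (Y : topologicalType) :=
  SmoothStructure {
  charts : set (chart R n Y) ;
  charts_cover : forall y, exists2 c, charts c & dom c y ;
  charts_compatible : forall c d, charts c -> charts d ->
    smooth (coord c @` (dom c `&` dom d)) (transition c d)
}.

(* Representation of [f] in the charts [c] and [d], defined on the part of the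
   range of [c] that [f] maps into the domain of [d]. *)
Definition local_dom (R : realType) (n : nat) (Y : topologicalType)
  (c d : chart R n Y) (f : Y -> Y) : set 'rV[R]_n :=
  coord c @` (dom c `&` f @^-1` dom d).

Definition local_rep (R : realType) (n : nat) (Y : topologicalType)
  (c d : chart R n Y) (f : Y -> Y) : 'rV[R]_n -> 'rV[R]_n :=
  coord d \o f \o param c.

Definition C1_map (R : realType) (n : nat) (Y : topologicalType)
  (A : smooth_structure R n Y) (f : Y -> Y) : Prop :=
  continuous f /\
  forall c d, charts A c -> charts A d -> Ck 1 (local_dom c d f) (local_rep c d f).

Definition bilin (R : realType) (n : nat) (G : 'M[R]_n) (v w : 'rV[R]_n) : R :=
  (v *m G *m w^T) 0 0.

(* [gram c x] is the Gram matrix, at the point with coordinates [x], of the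
   coordinate vector fields of the chart [c].  A tangent vector at [y] is
   represented by its coordinates [v] in some chart around [y]; the last field
   says that its length does not depend on this chart. *)
Record riemannian_metric (R : realType) (n : nat) (Y : topologicalType)
    (A : smooth_structure R n Y) := RiemannianMetric {
  gram : chart R n Y -> 'rV[R]_n -> 'M[R]_n ;
  gram_smooth : forall c, charts A c -> smooth (coord c @` dom c) (gram c) ;
  gram_sym : forall c x, charts A c -> (coord c @` dom c) x ->
    (gram c x)^T = gram c x ;
  gram_posdef : forall c x v, charts A c -> (coord c @` dom c) x -> v != 0 ->
    0 < bilin (gram c x) v v ;
  gram_compatible : forall c d y v w, charts A c -> charts A d -> dom c y -> dom d y ->
    bilin (gram d (coord d y)) ('d (transition c d) (coord c y) v)
                               ('d (transition c d) (coord c y) w)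
    = bilin (gram c (coord c y)) v w
}.

(* Length of the tangent vector at [y] with coordinates [v] in the chart [c]. *)
Definition rnorm (R : realType) (n : nat) (Y : topologicalType)
  (A : smooth_structure R n Y) (rho : riemannian_metric A)
  (c : chart R n Y) (y : Y) (v : 'rV[R]_n) : R :=
  Num.sqrt (bilin (gram rho c (coord c y)) v v).

Section curvature.
Variables (R : realType) (n : nat) (G : 'rV[R]_n -> 'M[R]_n).

Definition partial (i : 'I_n) (f : 'rV[R]_n -> R) : 'rV[R]_n -> R :=
  'D_(delta_mx 0 i) f.

(* [christoffel k i j] is Gamma^k_{ij}. *)
Definition christoffel (k i j : 'I_n) (x : 'rV[R]_n) : R :=
  2^-1 * \sum_(l < n) invmx (G x) k l *
    (partial i (fun z => G z j l) x + partial j (fun z => G z i l) x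
     - partial l (fun z => G z i j) x).

(* [riemann l k i j] is R^l_{kij}, the l-th component of
   R(d_i, d_j) d_k. *)
Definition riemann (l k i j : 'I_n) (x : 'rV[R]_n) : R :=
  partial i (christoffel l j k) x - partial j (christoffel l i k) x
  + \sum_(m < n) (christoffel l i m x * christoffel m j k x
                  - christoffel l j m x * christoffel m i k x).

End curvature.

Definition flat_metric (R : realType) (n : nat) (Y : topologicalType)
  (A : smooth_structure R n Y) (rho : riemannian_metric A) : Prop :=
  forall c x l k i j, charts A c -> (coord c @` dom c) x ->
    riemann (gram rho c) l k i j x = 0.

Definition flat_manifold (R : realType) (n : nat) (Y : topologicalType)
  (A : smooth_structure R n Y) (rho : riemannian_metric A) : Prop :=
  [/\ (0 < n)%N,
      hausdorff_space Y /\ @second_countable Y,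
      compact [set: Y],
      connected [set: Y] &
      flat_metric rho].

Definition expanding_endomorphism (R : realType) (n : nat)
  (Y : topologicalType) (A : smooth_structure R n Y) (g : Y -> Y) : Prop :=
  C1_map A g /\
  exists (rho : riemannian_metric A) (C lambda : R),
    [/\ 0 < C, 1 < lambda &
        forall k, (1 <= k)%N ->
        forall c d y v, charts A c -> charts A d -> dom c y -> dom d (iter k g y) ->
          C * lambda ^+ k * rnorm rho c y v <=
          rnorm rho d (iter k g y)
            ('d (local_rep c d (iter k g)) (coord c y) v)].

Lemma expanding_continuous (R : realType) (n : nat) (Y : topologicalType)
  (A : smooth_structure R n Y) (g : Y -> Y) :
  expanding_endomorphism A g -> continuous g.
Proof. by case; case. Qed.

Section within.

Lemma within_comp (T U V : topologicalType) (A : set T) (B : set U)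
    (f : T -> U) (g : U -> V) :
  {within B, continuous g} -> {within A, continuous f} ->
  (forall x, A x -> B (f x)) -> {within A, continuous (g \o f)}.
Proof.
move=> /continuousP cg /continuousP cf fAB; apply/continuousP => O oO.
have /open_subspaceP [W oW WB] := cg _ oO.
have /open_subspaceP [Z oZ ZA] := cf _ oW.
apply/open_subspaceP; exists Z => //; rewrite ZA.
apply/seteqP; split => x /= [h Ax]; split => //.
- have : (W `&` B) (f x) by split => //; exact: fAB.
  by rewrite WB => -[].
- have : (g @^-1` O `&` B) (f x) by split => //; exact: fAB.
  by rewrite -WB => -[].
Qed.

Lemma within_paste (R : realType) (T U : topologicalType) (D : set T)
    (p : T -> R) (a : R) (f g : T -> U) :
  closed D -> continuous p ->
  {within D `&` [set x | p x <= a], continuous f} ->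
  {within D `&` [set x | a <= p x], continuous g} ->
  (forall x, D x -> p x = a -> f x = g x) ->
  {within D, continuous (fun x => if p x <= a then f x else g x)}.
Proof.
move=> cD cp cf cg fg.
have -> : D = (D `&` [set x | p x <= a]) `|` (D `&` [set x | a <= p x]).
  apply/seteqP; split => x; last by case=> -[].
  by move=> Dx; have [h|/ltW h] := leP (p x) a; [left|right].
have cle : closed [set x | p x <= a].
  have -> : [set x | p x <= a] = p @^-1` [set y | y <= a] by [].
  by apply: preimage_closed; [move=> x _; exact: cp|exact: closed_le].
have cge : closed [set x | a <= p x].
  have -> : [set x | a <= p x] = p @^-1` [set y | a <= y] by [].
  by apply: preimage_closed; [move=> x _; exact: cp|exact: closed_ge].
apply: withinU_continuous; [exact: closedI|exact: closedI| |].
- apply: subspace_eq_continuous cf => x; rewrite inE /= => -[_ h].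
  by rewrite /= /from_subspace /= h.
- apply: subspace_eq_continuous cg => x; rewrite inE /= => -[Dx h].
  rewrite /= /from_subspace /=; case: ifP => // h'; rewrite fg //.
  by apply/eqP; rewrite eq_le h h'.
Qed.

Lemma pair_continuous (T U V : topologicalType) (f : T -> U) (g : T -> V) :
  continuous f -> continuous g -> continuous (fun x => (f x, g x)).
Proof.
move=> cf cg x; apply: (@cvg_pair _ _ _ _ (nbhs (f x)) (nbhs (g x))).
- exact: cf.
- exact: cg.
Qed.

End within.

Section loops.
Variables (R : realType) (Y : topologicalType) (y0 : Y).

Definition I01 : set R := [set t | 0 <= t <= 1].

(* Only the values on the unit interval matter: loops that agree there are
   identified in the fundamental group. *)
Record loop := Loop {
  loop_fun :> R -> Y ;
  loop_continuous : {within I01, continuous loop_fun} ;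
  loop0 : loop_fun 0 = y0 ;
  loop1 : loop_fun 1 = y0
}.

Arguments loop_continuous : clear implicits.

HB.instance Definition _ := gen_eqMixin loop.
HB.instance Definition _ := gen_choiceMixin loop.

Definition homotopic (f g : loop) : Prop :=
  exists H : R * R -> Y,
    [/\ {within I01 `*` I01, continuous H},
        forall t, I01 t -> H (0, t) = f t,
        forall t, I01 t -> H (1, t) = g t &
        forall s, I01 s -> H (s, 0) = y0 /\ H (s, 1) = y0].

Definition concat_fun (f g : R -> Y) (t : R) : Y :=
  if t <= 2^-1 then f (2 * t) else g (2 * t - 1).

Lemma closed_I01 : closed I01.
Proof.
have -> : I01 = [set t | t <= 1] `&` [set t | 0 <= t].
  by apply/seteqP; split => t /=; rewrite /I01 /=; [case/andP|case=> -> ->].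
by apply: closedI; [exact: closed_le|exact: closed_ge].
Qed.

Lemma closed_I01X : closed (I01 `*` I01).
Proof.
have -> : I01 `*` I01 = (fst @^-1` I01) `&` (snd @^-1` I01 : set (R * R)) by [].
apply: closedI; apply: preimage_closed => //; try exact: closed_I01.
- by move=> x _; exact: cvg_fst.
- by move=> x _; exact: cvg_snd.
Qed.

Lemma concat_continuous (f g : loop) : {within I01, continuous (concat_fun f g)}.
Proof.
apply: (@within_paste _ _ _ _ id _ (fun t => f (2 * t)) (fun t => g (2 * t - 1))).
- exact: closed_I01.
- by move=> x.
- apply: (@within_comp _ _ _ _ _ (fun t : R => 2 * t) _ (loop_continuous f)).
    by apply: continuous_subspaceT => x; apply: mulrl_continuous.
  by move=> x /=; rewrite /I01 /= => -[/andP[? ?] ?]; apply/andP; split; lra.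
- apply: (@within_comp _ _ _ _ _ (fun t : R => 2 * t - 1) _ (loop_continuous g)).
    apply: continuous_subspaceT => x; apply: cvgB; last exact: cvg_cst.
    exact: mulrl_continuous.
  by move=> x /=; rewrite /I01 /= => -[/andP[? ?] ?]; apply/andP; split; lra.
- move=> x _ /= ->; have -> : 2 * 2^-1 = 1 :> R by lra.
  by rewrite subrr loop0 loop1.
Qed.

Lemma concat0 (f g : loop) : concat_fun f g 0 = y0.
Proof. by rewrite /concat_fun ifT ?mulr0 ?loop0//; lra. Qed.

Lemma concat1 (f g : loop) : concat_fun f g 1 = y0.
Proof.
rewrite /concat_fun ifF; last by apply/negbTE; rewrite -ltNge; lra.
have -> : 2 * 1 - 1 = 1 :> R by lra.
by rewrite loop1.
Qed.

Definition concat (f g : loop) : loop :=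
  Loop (@concat_continuous f g) (concat0 f g) (concat1 f g).

Lemma const_continuous : {within I01, continuous (fun _ : R => y0)}.
Proof. by apply: continuous_subspaceT => x; exact: cvg_cst. Qed.

Definition const_loop : loop := Loop const_continuous erefl erefl.

Lemma reverse_continuous (f : loop) :
  {within I01, continuous (fun t => f (1 - t))}.
Proof.
apply: (@within_comp _ _ _ _ _ (fun t : R => 1 - t) _ (loop_continuous f)).
  apply: continuous_subspaceT => x; apply: cvgB; first exact: cvg_cst.
  exact: cvg_id.
by move=> x /=; rewrite /I01 /= => /andP[? ?]; apply/andP; split; lra.
Qed.

Lemma reverse0 (f : loop) : f (1 - 0) = y0.
Proof. by rewrite subr0 loop1. Qed.

Lemma reverse1 (f : loop) : f (1 - 1) = y0.
Proof. by rewrite subrr loop0. Qed.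

Definition reverse (f : loop) : loop :=
  Loop (@reverse_continuous f) (reverse0 f) (reverse1 f).

(* Two reparametrizations with the same endpoints are homotopic, by the
   straight-line homotopy between the parameters. *)
Lemma homotopic_reparam (f u v : loop) (phi psi : R -> R) :
  continuous phi -> continuous psi ->
  (forall t, I01 t -> I01 (phi t)) -> (forall t, I01 t -> I01 (psi t)) ->
  phi 0 = psi 0 -> phi 1 = psi 1 ->
  (forall t, I01 t -> u t = f (phi t)) ->
  (forall t, I01 t -> v t = f (psi t)) -> homotopic u v.
Proof.
move=> cphi cpsi iphi ipsi e0 e1 uE vE.
have I0 : I01 0 by rewrite /I01 /= lexx ler01.
have I1 : I01 1 by rewrite /I01 /= lexx ler01.
pose K (x : R * R) := (1 - x.1) * phi x.2 + x.1 * psi x.2.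
exists (f \o K); split.
- apply: (within_comp (loop_continuous f)).
    apply: continuous_subspaceT => x; apply: cvgD; apply: cvgM.
    + by apply: cvgB; [exact: cvg_cst|exact: cvg_fst].
    + by apply: (@continuous_comp _ _ _ snd phi); [exact: cvg_snd|exact: cphi].
    + exact: cvg_fst.
    + by apply: (@continuous_comp _ _ _ snd psi); [exact: cvg_snd|exact: cpsi].
  move=> [s t] /= [/= /andP[s0 s1] It]; rewrite /K /=.
  have /andP[a0 a1] := iphi _ It; have /andP[b0 b1] := ipsi _ It.
  have s1' : 0 <= 1 - s by lra.
  apply/andP; split; first by apply: addr_ge0; apply: mulr_ge0.
  apply: le_trans (lerD (ler_wpM2l s1' a1) (ler_wpM2l s0 b1)) _.
  by rewrite !mulr1 subrK.
- by move=> t It; rewrite /= /K /= subr0 mul1r mul0r addr0 uE.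
- by move=> t It; rewrite /= /K /= subrr mul0r mul1r add0r vE.
- move=> s Is; rewrite /= /K /= e0 e1 -!mulrDl subrK !mul1r.
  by rewrite -vE// -vE// loop0 loop1.
Qed.

Lemma homotopic_refl (f : loop) : homotopic f f.
Proof. by apply: (@homotopic_reparam f f f id id) => // x; exact: cvg_id. Qed.

Lemma homotopic_sym (f g : loop) : homotopic f g -> homotopic g f.
Proof.
move=> [H [cH Hf Hg Hy]]; exists (H \o (fun x : R * R => (1 - x.1, x.2))); split.
- apply: (within_comp cH).
    apply: continuous_subspaceT; apply: pair_continuous => x; last exact: cvg_snd.
    by apply: cvgB; [exact: cvg_cst|exact: cvg_fst].
  move=> [s t] /= [/= /andP[s0 s1] It]; split => //=.
  by apply/andP; split; lra.
- by move=> t It; rewrite /= subr0 Hg.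
- by move=> t It; rewrite /= subrr Hf.
- by move=> s /andP[s0 s1] /=; apply: Hy; apply/andP; split; lra.
Qed.

Lemma homotopic_trans (f g h : loop) :
  homotopic f g -> homotopic g h -> homotopic f h.
Proof.
move=> [H [cH Hf Hg Hy]] [K [cK Kg Kh Ky]].
exists (fun x : R * R => if x.1 <= 2^-1 then (H \o (fun x => (2 * x.1, x.2))) x
  else (K \o (fun x => (2 * x.1 - 1, x.2))) x); split.
- apply: (@within_paste _ _ _ _ fst) => /=.
  + exact: closed_I01X.
  + by move=> x; exact: cvg_fst.
  + apply: (within_comp cH).
      apply: continuous_subspaceT; apply: pair_continuous => x; last exact: cvg_snd.
      by apply: cvgM; [exact: cvg_cst|exact: cvg_fst].
    move=> [s t] /= [[/= /andP[s0 s1] It] ?]; split => //=.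
    by apply/andP; split; lra.
  + apply: (within_comp cK).
      apply: continuous_subspaceT; apply: pair_continuous => x; last exact: cvg_snd.
      apply: cvgB; last exact: cvg_cst.
      by apply: cvgM; [exact: cvg_cst|exact: cvg_fst].
    move=> [s t] /= [[/= /andP[s0 s1] It] ?]; split => //=.
    by apply/andP; split; lra.
  + move=> [s t] /= [/= _ It] ->; have -> : 2 * 2^-1 = 1 :> R by lra.
    by rewrite subrr Hg// Kg.
- by move=> t It /=; rewrite ifT ?mulr0 ?Hf//; lra.
- move=> t It /=; rewrite ifF; last by apply/negbTE; rewrite -ltNge; lra.
  have -> : 2 * 1 - 1 = 1 :> R by lra.
  by rewrite Kh.
- move=> s /andP[s0 s1] /=; case: leP => hs.
    by apply: Hy; apply/andP; split; lra.
  by apply: Ky; apply/andP; split; lra.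
Qed.

Lemma homotopic_concat (f f' g g' : loop) :
  homotopic f f' -> homotopic g g' -> homotopic (concat f g) (concat f' g').
Proof.
move=> [H [cH Hf Hf' Hy]] [K [cK Kg Kg' Ky]].
exists (fun x : R * R => if x.2 <= 2^-1 then (H \o (fun x => (x.1, 2 * x.2))) x
  else (K \o (fun x => (x.1, 2 * x.2 - 1))) x); split.
- apply: (@within_paste _ _ _ _ snd) => /=.
  + exact: closed_I01X.
  + by move=> x; exact: cvg_snd.
  + apply: (within_comp cH).
      apply: continuous_subspaceT; apply: pair_continuous => x; first exact: cvg_fst.
      by apply: cvgM; [exact: cvg_cst|exact: cvg_snd].
    move=> [s t] /= [[/= Is /andP[t0 t1]] ?]; split => //=.
    by apply/andP; split; lra.
  + apply: (within_comp cK).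
      apply: continuous_subspaceT; apply: pair_continuous => x; first exact: cvg_fst.
      apply: cvgB; last exact: cvg_cst.
      by apply: cvgM; [exact: cvg_cst|exact: cvg_snd].
    move=> [s t] /= [[/= Is /andP[t0 t1]] ?]; split => //=.
    by apply/andP; split; lra.
  + move=> [s t] /= [/= Is It] ->; have -> : 2 * 2^-1 = 1 :> R by lra.
    by rewrite subrr (Hy _ Is).2 (Ky _ Is).1.
- move=> t /andP[t0 t1] /=; rewrite /concat_fun; case: leP => ht.
    by apply: Hf; apply/andP; split; lra.
  by apply: Kg; apply/andP; split; lra.
- move=> t /andP[t0 t1] /=; rewrite /concat_fun; case: leP => ht.
    by apply: Hf'; apply/andP; split; lra.
  by apply: Kg'; apply/andP; split; lra.
- move=> s Is /=; split.
    by rewrite ifT ?mulr0 ?(Hy _ Is).1//; lra.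
  rewrite ifF; last by apply/negbTE; rewrite -ltNge; lra.
  have -> : 2 * 1 - 1 = 1 :> R by lra.
  by rewrite (Ky _ Is).2.
Qed.

Lemma homotopic_reverse (f g : loop) :
  homotopic f g -> homotopic (reverse f) (reverse g).
Proof.
move=> [H [cH Hf Hg Hy]]; exists (H \o (fun x : R * R => (x.1, 1 - x.2))); split.
- apply: (within_comp cH).
    apply: continuous_subspaceT; apply: pair_continuous => x; first exact: cvg_fst.
    by apply: cvgB; [exact: cvg_cst|exact: cvg_snd].
  move=> [s t] /= [/= Is /andP[t0 t1]]; split => //=.
  by apply/andP; split; lra.
- by move=> t /andP[t0 t1] /=; apply: Hf; apply/andP; split; lra.
- by move=> t /andP[t0 t1] /=; apply: Hg; apply/andP; split; lra.
- by move=> s Is /=; rewrite subr0 subrr; split; case: (Hy _ Is).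
Qed.

Lemma max_continuous (u v : R -> R) : continuous u -> continuous v ->
  continuous (fun t => Num.max (u t) (v t)).
Proof. by move=> cu cv x; apply: continuous_max; [exact: cu|exact: cv]. Qed.

Lemma min_continuous (u v : R -> R) : continuous u -> continuous v ->
  continuous (fun t => Num.min (u t) (v t)).
Proof. by move=> cu cv x; apply: continuous_min; [exact: cu|exact: cv]. Qed.

Lemma affine_continuous (a b : R) : continuous (fun t : R => a * t + b).
Proof.
by move=> x; apply: cvgD; [exact: mulrl_continuous|exact: cvg_cst].
Qed.

Lemma concatA (f g h : loop) :
  homotopic (concat f (concat g h)) (concat (concat f g) h).
Proof.
pose phi (t : R) := Num.max (2^-1 * t + 0)
  (Num.max (1 * t - 2^-1 * 2^-1) (2 * t - 1)).
apply: (@homotopic_reparam (concat (concat f g) h) _ _ phi id) => //.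
- by apply: max_continuous; [|apply: max_continuous]; exact: affine_continuous.
- by move=> x; exact: cvg_id.
- move=> t /andP[t0 t1]; rewrite /phi /I01 /= !ge_max !le_max.
  apply/andP; split; first by apply/orP; left; lra.
  by apply/and3P; split; lra.
- by rewrite /phi /=; case: (leP (1 * _ - _)) => ?; case: leP => ?; lra.
- by rewrite /phi /=; case: (leP (1 * _ - _)) => ?; case: leP => ?; lra.
- move=> t /andP[t0 t1] /=; rewrite /concat_fun /=.
  have [ht|ht] := leP t 2^-1.
    have -> : phi t = 2^-1 * t.
      by rewrite /phi /=; case: (leP (1 * _ - _)) => ?; case: leP => ?; lra.
    rewrite ifT; last by lra.
    by rewrite /concat_fun ifT; [congr (f _)|]; lra.
  rewrite /concat_fun; have [ht'|ht'] := leP (2 * t - 1) 2^-1.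
    have -> : phi t = t - 2^-1 * 2^-1.
      by rewrite /phi /=; case: (leP (1 * _ - _)) => ?; case: leP => ?; lra.
    rewrite ifT; last by lra.
    rewrite ifF; last by apply/negbTE; rewrite -ltNge; lra.
    by congr (g _); lra.
  have -> : phi t = 2 * t - 1.
    by rewrite /phi /=; case: (leP (1 * _ - _)) => ?; case: leP => ?; lra.
  by rewrite ifF//; apply/negbTE; rewrite -ltNge; lra.
Qed.

Lemma concat_const_l (f : loop) : homotopic (concat const_loop f) f.
Proof.
pose phi (t : R) := Num.max (0 * t + 0) (2 * t - 1).
apply: (@homotopic_reparam f _ _ phi id) => //.
- by apply: max_continuous; exact: affine_continuous.
- by move=> x; exact: cvg_id.
- move=> t /andP[t0 t1]; rewrite /phi /I01 /=.
  by case: (leP (_ * t + _)) => ?; apply/andP; split; lra.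
- by rewrite /phi /=; case: leP => ?; lra.
- by rewrite /phi /=; case: leP => ?; lra.
- move=> t /andP[t0 t1] /=; rewrite /concat_fun /=.
  have [ht|ht] := leP t 2^-1.
    have -> : phi t = 0.
      by rewrite /phi /=; case: leP => ?; lra.
    by rewrite loop0.
  by congr (f _); rewrite /phi /=; case: leP => ?; lra.
Qed.

Lemma concat_const_r (f : loop) : homotopic (concat f const_loop) f.
Proof.
pose phi (t : R) := Num.min (2 * t + 0) (0 * t + 1).
apply: (@homotopic_reparam f _ _ phi id) => //.
- by apply: min_continuous; exact: affine_continuous.
- by move=> x; exact: cvg_id.
- move=> t /andP[t0 t1]; rewrite /phi /I01 /=.
  by case: (leP (_ * t + _)) => ?; apply/andP; split; lra.
- by rewrite /phi /=; case: leP => ?; lra.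
- by rewrite /phi /=; case: leP => ?; lra.
- move=> t /andP[t0 t1] /=; rewrite /concat_fun /=.
  have [ht|ht] := leP t 2^-1.
    by congr (f _); rewrite /phi /=; case: leP => ?; lra.
  have -> : phi t = 1.
    by rewrite /phi /=; case: leP => ?; lra.
  by rewrite loop1.
Qed.

Lemma concat_reverse_r (f : loop) : homotopic (concat f (reverse f)) const_loop.
Proof.
pose phi (t : R) := Num.min (2 * t + 0) (- 2 * t + 2).
apply: (@homotopic_reparam f _ _ phi (fun=> 0)) => //.
- by apply: min_continuous; exact: affine_continuous.
- by move=> x; exact: cvg_cst.
- move=> t /andP[t0 t1]; rewrite /phi /I01 /=.
  by case: (leP (_ * t + _)) => ?; apply/andP; split; lra.
- by move=> t _; rewrite /I01 /= lexx ler01.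
- by rewrite /phi /=; case: leP => ?; lra.
- by rewrite /phi /=; case: leP => ?; lra.
- move=> t /andP[t0 t1] /=; rewrite /concat_fun /=.
  by have [ht|ht] := leP t 2^-1; congr (f _);
    rewrite /phi /=; case: leP => ?; lra.
- by move=> t _; rewrite loop0.
Qed.

Lemma concat_reverse_l (f : loop) : homotopic (concat (reverse f) f) const_loop.
Proof.
pose phi (t : R) := Num.max (- 2 * t + 1) (2 * t - 1).
apply: (@homotopic_reparam f _ _ phi (fun=> 1)) => //.
- by apply: max_continuous; exact: affine_continuous.
- by move=> x; exact: cvg_cst.
- move=> t /andP[t0 t1]; rewrite /phi /I01 /=.
  by case: (leP (_ * t + _)) => ?; apply/andP; split; lra.
- by move=> t _; rewrite /I01 /= lexx ler01.
- by rewrite /phi /=; case: leP => ?; lra.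
- by rewrite /phi /=; case: leP => ?; lra.
- move=> t /andP[t0 t1] /=; rewrite /concat_fun /=.
  by have [ht|ht] := leP t 2^-1; congr (f _);
    rewrite /phi /=; case: leP => ?; lra.
- by move=> t _; rewrite loop1.
Qed.

Definition homotopicb : rel loop := fun f g => `[< homotopic f g >].

Lemma homotopicb_equiv : equiv_class_of homotopicb.
Proof.
split.
- by move=> f; apply/asboolP; exact: homotopic_refl.
- by move=> f g; apply/asboolP/asboolP; exact: homotopic_sym.
- move=> g f h /asboolP fg /asboolP gh; apply/asboolP.
  exact: homotopic_trans gh.
Qed.

Canonical homotopic_equiv := EquivRelPack homotopicb_equiv.

Definition pi1 : Type := {eq_quot homotopic_equiv}.

HB.instance Definition _ := Choice.on pi1.
HB.instance Definition _ := EqQuotient.on pi1.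

Definition pi1_class (f : loop) : pi1 := \pi_pi1 f.

Lemma pi1_classP (f g : loop) : pi1_class f = pi1_class g <-> homotopic f g.
Proof. by split=> [/eqquotP/asboolP|h]; last exact/eqquotP/asboolP. Qed.

Lemma pi1_reprK (a : pi1) : pi1_class (repr a) = a.
Proof. exact: reprK. Qed.

Lemma pi1_repr_class (f : loop) : homotopic (repr (pi1_class f)) f.
Proof. by apply/pi1_classP; rewrite pi1_reprK. Qed.

Definition pi1_mul (a b : pi1) : pi1 := pi1_class (concat (repr a) (repr b)).
Definition pi1_one : pi1 := pi1_class const_loop.
Definition pi1_inv (a : pi1) : pi1 := pi1_class (reverse (repr a)).

Lemma pi1_mul_class (f g : loop) :
  pi1_mul (pi1_class f) (pi1_class g) = pi1_class (concat f g).
Proof. by apply/pi1_classP; apply: homotopic_concat; exact: pi1_repr_class. Qed.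

Lemma pi1_inv_class (f : loop) : pi1_inv (pi1_class f) = pi1_class (reverse f).
Proof. by apply/pi1_classP; apply: homotopic_reverse; exact: pi1_repr_class. Qed.

Lemma pi1_mulA : associative pi1_mul.
Proof.
move=> a b c; rewrite -(pi1_reprK a) -(pi1_reprK b) -(pi1_reprK c).
by rewrite !pi1_mul_class; apply/pi1_classP; exact: concatA.
Qed.

Lemma pi1_mul1 : left_id pi1_one pi1_mul.
Proof.
move=> a; rewrite -(pi1_reprK a) pi1_mul_class.
by apply/pi1_classP; exact: concat_const_l.
Qed.

Lemma pi1_mulr1 : right_id pi1_one pi1_mul.
Proof.
move=> a; rewrite -(pi1_reprK a) pi1_mul_class.
by apply/pi1_classP; exact: concat_const_r.
Qed.

Lemma pi1_mulV : left_inverse pi1_one pi1_inv pi1_mul.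
Proof.
move=> a; rewrite -(pi1_reprK a) pi1_inv_class pi1_mul_class.
by apply/pi1_classP; exact: concat_reverse_l.
Qed.

Lemma pi1_mulrV : right_inverse pi1_one pi1_inv pi1_mul.
Proof.
move=> a; rewrite -(pi1_reprK a) pi1_inv_class pi1_mul_class.
by apply/pi1_classP; exact: concat_reverse_r.
Qed.

HB.instance Definition _ :=
  isGroup.Build pi1 pi1_mulA pi1_mul1 pi1_mulr1 pi1_mulV pi1_mulrV.

Lemma pi1_mulE (a b : pi1) : (a * b)%g = pi1_mul a b.
Proof. by []. Qed.

End loops.

Arguments loop_continuous {R Y y0} l.

Section induced.
Variables (R : realType) (Y : topologicalType) (y0 : Y).
Variables (g : Y -> Y) (g_cont : continuous g) (g_fix : g y0 = y0).

Lemma loop_map_continuous (f : loop R y0) :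
  {within @I01 R, continuous (g \o f)}.
Proof.
apply: (within_comp (B := setT) _ (loop_continuous f)) => //.
exact: continuous_subspaceT.
Qed.

Lemma loop_map0 (f : loop R y0) : (g \o f) 0 = y0.
Proof. by rewrite /= loop0. Qed.

Lemma loop_map1 (f : loop R y0) : (g \o f) 1 = y0.
Proof. by rewrite /= loop1. Qed.

Definition loop_map (f : loop R y0) : loop R y0 :=
  Loop (@loop_map_continuous f) (loop_map0 f) (loop_map1 f).

Lemma homotopic_map (f h : loop R y0) :
  homotopic f h -> homotopic (loop_map f) (loop_map h).
Proof.
move=> [H [cH Hf Hh Hy]]; exists (g \o H); split => /=.
- apply: (within_comp (B := setT) _ cH) => //.
  exact: continuous_subspaceT.
- by move=> t It; rewrite Hf.
- by move=> t It; rewrite Hh.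
- by move=> s /Hy [-> ->].
Qed.

Definition pi1_map (a : pi1 R y0) : pi1 R y0 := pi1_class (loop_map (repr a)).

Lemma pi1_map_class (f : loop R y0) :
  pi1_map (pi1_class f) = pi1_class (loop_map f).
Proof. by apply/pi1_classP; apply: homotopic_map; exact: pi1_repr_class. Qed.

Lemma pi1_mapM (a b : pi1 R y0) :
  pi1_map (a * b)%g = (pi1_map a * pi1_map b)%g.
Proof.
rewrite -(pi1_reprK a) -(pi1_reprK b) !pi1_mulE pi1_mul_class.
rewrite !pi1_map_class pi1_mul_class.
apply/pi1_classP; apply: (@homotopic_reparam _ _ _
  (loop_map (concat (repr a) (repr b))) _ _ id id) => //.
- by move=> x; exact: cvg_id.
- by move=> x; exact: cvg_id.
- by move=> t _ /=; rewrite /concat_fun /=; case: ifP.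
Qed.

End induced.

Section odometer.
Variables (G : groupType) (phi : G -> G).

Definition lcoset_of (a : G) (H : set G) : set G := [set (a * h)%g | h in H].

Definition odometer_subgroup (i : nat) : set G := range (iter i phi).

Definition odometer_level (i : nat) : set (set G) :=
  [set S | exists a, S = lcoset_of a (odometer_subgroup i)].

(* The bonding map sends a coset of the (i+1)-st subgroup to the coset of the
   i-th subgroup that contains it. *)
Record odometer := Odometer {
  thread :> nat -> set G ;
  thread_level : forall i, odometer_level i (thread i) ;
  thread_compatible : forall i, thread i.+1 `<=` thread i
}.

HB.instance Definition _ := gen_eqMixin odometer.
HB.instance Definition _ := gen_choiceMixin odometer.
HB.instance Definition _ := Topological.copy odometer
  (initial_topology (fun w : odometer => (thread w :
     prod_topology (fun _ : nat => discrete_topology (set G))))).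

Lemma odometer_eq (w w' : odometer) : (forall i, w i = w' i) -> w = w'.
Proof.
case: w w' => [w l c] [w' l' c'] /= /funext e; move: l c l' c'; rewrite e.
by move=> *; congr Odometer; exact: Prop_irrelevance.
Qed.

Lemma lcoset_of_mul (a b : G) (H : set G) :
  lcoset_of a (lcoset_of b H) = lcoset_of (a * b)%g H.
Proof.
apply/seteqP; split => x /=.
- by case=> _ [h Hh <-] <-; exists h => //; rewrite mulgA.
- by case=> h Hh <-; exists (b * h)%g; [exists h|rewrite mulgA].
Qed.

Lemma act_level (a : G) (w : odometer) (i : nat) :
  odometer_level i (lcoset_of a (w i)).
Proof.
by have [b ->] := thread_level w i; exists (a * b)%g; rewrite lcoset_of_mul.
Qed.

Lemma act_compatible (a : G) (w : odometer) (i : nat) :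
  lcoset_of a (w i.+1) `<=` lcoset_of a (w i).
Proof. exact/image_subset/thread_compatible. Qed.

Definition odometer_act (a : G) (w : odometer) : odometer :=
  Odometer (act_level a w) (@act_compatible a w).

Lemma odometer_act1 (w : odometer) : odometer_act 1%g w = w.
Proof.
apply: odometer_eq => i /=; apply/seteqP; split => x /=.
- by case=> h ? <-; rewrite mul1g.
- by move=> ?; exists x; rewrite ?mul1g.
Qed.

Lemma odometer_actM (a b : G) (w : odometer) :
  odometer_act (a * b)%g w = odometer_act a (odometer_act b w).
Proof. by apply: odometer_eq => i /=; rewrite lcoset_of_mul. Qed.

End odometer.

Definition free_action (G : groupType) (X : Type) (act : G -> X -> X) : Prop :=
  forall a x, a <> 1%g -> act a x <> x.

(* Main.v *)
Require Import Defs.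
From mathcomp Require Import all_boot all_order all_algebra.
From mathcomp Require Import all_classical all_reals all_analysis.
From mathcomp Require Import ring lra.

(* If [a] fixes a point of the odometer then, for every [i], [a] is conjugate to
   an element of the image of [g_*^i]; hence a loop representing [a] lifts
   through [g^i] to a closed loop.  As [g] is expanding, the size of these lifts
   tends to 0, and on a compact manifold a small loop is null-homotopic; pushing
   the null-homotopy forward by [g^i] gives [a = 1].
   Sizes are measured by pulling back the norm along an embedding [Phi] of [Y]
   in a normed space that is bi-Lipschitz with respect to the charts, which
   avoids lengths of paths; a large power of [g] expands the distance so
   obtained locally by a factor 2, and is open by the inverse function theorem. *)

Set Implicit Arguments.
Unset Strict Implicit.
Unset Printing Implicit Defensive.

(* Restores [Defs.coord], hidden by the coordinates of [vector]. *)
Import Defs.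
Import Order.TTheory GRing.Theory Num.Theory.
Import numFieldNormedType.Exports.

Local Open Scope classical_set_scope.
Local Open Scope ring_scope.

(** * Distances pulled back from a normed space *)

(** The conjugating element changes with [i], and so does the base point of the closed lift, which
    is some point over [y0]. Compactness is therefore used to make every constant independent of the
    point: the radius on which [f] expands, the radius on which it can be inverted, the size below
    which loops contract. Expansion is given only infinitesimally, for a Riemannian norm and with a
    constant [C] that may be less than 1. Let [M] compare, in suitable charts, the coordinates with
    [Phi] and with the metric. Replacing the metric by coordinates at source and target costs a
    factor [M], replacing [Phi] by coordinates costs another [M], and the error term of strict
    differentiability costs 1. So [f = g^k] at least doubles distances near each point once
    [C * lambda^k >= M * (2 * M + 1)]. Passing to this power is harmless: the conjugacy for [f^i] is
    the one for [g^(i * k)]. The doubling estimate does the work of covering theory: it makes chosen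
    preimages vary continuously, makes lifts unique, and halves their oscillation. *)

(** Near-covering form of compactness, with the right neighbourhoods of 0 as parameter filter. The
    local hypothesis covers all of []0, e]], so that it holds eventually along this filter. *)
Lemma compact_uniform_radius (R : realType) (X : topologicalType) (K : set X)
    (P : R -> X -> Prop) : compact K ->
  (forall x, K x -> exists U e, [/\ nbhs x U, 0 < e &
     forall u e', U u -> 0 < e' <= e -> P e' u]) ->
  exists2 e, 0 < e & forall x, K x -> P e x.
Proof.
move=> /compact_near_coveringP cK loc.
have /cK : forall x, K x -> \forall x' \near x & e \near 0^'+, P e x'.
  move=> x /loc [U [e [xU e0 UP]]].
  exists (U, [set e' | 0 < e' <= e]) => /=; last by case=> u e' /= [? ?]; exact: UP.
  split => //; near=> e' => /=; apply/andP; split; first by near: e'; exact: nbhs_right_gt.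
  by near: e'; exact: nbhs_right_le.
move=> H.
near (0 : R)^'+ => e; exists e; first by near: e; exact: nbhs_right_gt.
by move=> x Kx; apply: (near H e).
Unshelve. all: end_near. Qed.

Lemma compact_uniform_continuous (R : realType) (X : pseudoMetricType R)
    (V : normedModType R) (K : set X) (q : X -> V) :
  compact K -> continuous q ->
  forall e, 0 < e -> exists2 eta, 0 < eta &
    forall x y, K x -> ball x eta y -> `|q x - q y| < e.
Proof.
move=> cK cq e e0.
have [] := @compact_uniform_radius R X K
  (fun eta x => forall y, ball x eta y -> `|q x - q y| < e) cK.
  move=> x Kx.
  have /cvgrPdist_lt/(_ (e / 2)) H := cq x.
  have /nbhs_ballP[r /= r0 rU] := H ltac:(lra).
  exists (ball x (r / 2)), (r / 2); split; [|lra|].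
    by apply: nbhsx_ballx; lra.
  move=> u e' xu /andP[e'0 e'r] y uy.
  have h1 : `|q x - q u| < e / 2.
    by apply: rU; apply: le_ball xu; lra.
  have h2 : `|q x - q y| < e / 2.
    apply: rU; have := ball_triangle xu uy; apply: le_ball; lra.
  have := ler_distD (q x) (q u) (q y); rewrite (distrC (q u) (q x)); lra.
by move=> eta eta0 H; exists eta => // x y Kx; exact: H.
Qed.

Section metric.
Variables (R : realType) (Y : topologicalType) (V : normedModType R).
Variable (Phi : Y -> V).
Hypothesis cY : compact [set: Y].
Hypothesis cPhi : continuous Phi.
Hypothesis iPhi : injective Phi.

Local Notation D u v := (`|Phi u - Phi v|).

Lemma pullback_dist_tri u v w : D u w <= D u v + D v w.
Proof. exact: ler_distD. Qed.

Lemma pullback_ball_nbhs y e : 0 < e -> nbhs y [set z | D y z < e].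
Proof. by move=> e0; have /cvgrPdist_lt/(_ e e0) := cPhi (x := y). Qed.

(** Compactness makes the continuous injection [Phi] an embedding: the complement of an open
    neighbourhood of [y] is compact, and the distance to [y] is positive on it, hence bounded
    below. *)
Lemma pullback_nbhs_ball y (U : set Y) : nbhs y U ->
  exists2 e, 0 < e & forall z, D y z < e -> U z.
Proof.
rewrite nbhsE => -[W [oW Wy] WU].
have cK : compact (~` W).
  by apply: (subclosed_compact _ cY) => //; exact: open_closedC.
have [] := @compact_uniform_radius R Y (~` W) (fun e z => e <= D y z) cK.
  move=> z Wz; have yz : 0 < D y z.
    rewrite normr_gt0 subr_eq0; apply/eqP => /iPhi yz.
    by apply: Wz; rewrite -yz.
  exists [set u | D z u < D y z / 2], (D y z / 2); split; [|lra|].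
    by apply: pullback_ball_nbhs; lra.
  move=> u e' /= zu /andP[e'0 e'r].
  by have := pullback_dist_tri y u z; rewrite (distrC (Phi u) (Phi _)); lra.
move=> e e0 H; exists e => // z yz; apply: WU; apply: contrapT => /H.
lra.
Qed.

(** Lebesgue number principle: a property that persists when [e] shrinks and holds locally holds
    with a single [e]. *)
Lemma pullback_lebesgue (P : R -> Y -> Prop) :
  (forall e e' u, 0 < e' <= e -> P e u -> P e' u) ->
  (forall y : Y, exists2 e, 0 < e & \forall u \near y, P e u) ->
  exists2 e, 0 < e & forall y, P e y.
Proof.
move=> mP loc; have [] := @compact_uniform_radius R Y setT P cY.
  move=> y _; have [e e0 yP] := loc y; exists (P e), e; split => //.
  by move=> u e' Pu ee'; exact: mP ee' Pu.
by move=> e e0 H; exists e => // y; exact: H.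
Qed.

Lemma pullback_nbhs_uniform (y : Y) (U : set Y) : nbhs y U ->
  exists2 e, 0 < e & \forall u \near y, forall z, D u z < e -> U z.
Proof.
move=> /pullback_nbhs_ball[e e0 eU]; exists (e / 2); first by lra.
apply: filterS (@pullback_ball_nbhs y (e / 2) _); last by lra.
move=> u /= yu z uz; apply: eU; have := pullback_dist_tri y u z; lra.
Qed.

Lemma pullback_continuous (T : topologicalType) (p : T -> Y) :
  continuous (Phi \o p) -> continuous p.
Proof.
move=> cp t U /pullback_nbhs_ball[e e0 eU].
have /cvgrPdist_lt/(_ e e0) H := cp t.
by apply: filterS H => u; exact: eU.
Qed.

Section expansion.
Variable f : Y -> Y.
Hypothesis cf : continuous f.
Hypothesis opf : forall y U, nbhs y U -> nbhs (f y) (f @` U).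
Hypothesis ef : forall y : Y, exists2 U : set Y, nbhs y U &
  forall u v, U u -> U v -> 2 * D u v <= D (f u) (f v).

Lemma uniform_expansion : exists2 dl, 0 < dl &
  forall u v, D u v < dl -> 2 * D u v <= D (f u) (f v).
Proof.
apply: (pullback_lebesgue
  (P := fun (dl : R) (u : Y) => forall v, D u v < dl -> 2 * D u v <= D (f u) (f v))).
  by move=> e e' u /andP[_ ee'] H v uv; apply: H; lra.
move=> y; have [U yU UE] := ef y; have [e e0 H] := pullback_nbhs_uniform yU.
exists e => //; apply: filterS2 H yU => u H Uu v /H Uv; exact: UE.
Qed.

(** Near [y], both [u] and the preimage found by openness lie in the ball of radius [eta / 2] around
    [y], hence within [eta] of each other. *)
Lemma uniform_openness eta : 0 < eta -> exists2 dl, 0 < dl &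
  forall u z, D (f u) z < dl -> exists2 u', f u' = z & D u u' < eta.
Proof.
move=> eta0; apply: (pullback_lebesgue
  (P := fun (dl : R) (u : Y) => forall z, D (f u) z < dl -> exists2 u', f u' = z & D u u' < eta)).
  by move=> e e' u /andP[_ ee'] H z uz; apply: H; lra.
move=> y; have yU : nbhs y [set u | D y u < eta / 2].
  by apply: pullback_ball_nbhs; lra.
have [e e0 H] := pullback_nbhs_uniform (opf yU).
exists e => //.
have H' : \forall u \near y, forall z, D (f u) z < e -> (f @` [set u | D y u < eta / 2]) z.
  exact: cf H.
apply: filterS2 H' yU => u /= fu yu z /fu.
case=> u' /= yu' <-; exists u' => //; have := pullback_dist_tri u y u'.
rewrite (distrC (Phi u) (Phi y)); lra.
Qed.

End expansion.
End metric.

(** * Lifting paths through an expanding map *)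

Section clamp.
Variable R : realType.

(** Retraction of the line onto the unit interval. Composing with it turns a path or homotopy that
    is continuous only within the interval or the square into one that is continuous everywhere. *)
Definition clamp01 (t : R) : R := Num.max 0 (Num.min t 1).

Lemma clamp01_I01 t : I01 (clamp01 t).
Proof.
by rewrite /I01 /clamp01 /= le_max lexx ge_max ler01 ge_min lexx orbT.
Qed.

Lemma clamp01_id t : I01 t -> clamp01 t = t.
Proof. by move=> /andP[t0 t1]; rewrite /clamp01 (min_idPl t1); exact/max_idPr. Qed.

Lemma clamp01_dist t u : `|clamp01 t - clamp01 u| <= `|t - u|.
Proof.
have [tu1 tu2] : t - u <= `|t - u| /\ u - t <= `|t - u|.
  by rewrite ler_norm distrC ler_norm.
rewrite ler_norml /clamp01 !maxEle !minEle.
by case: (leP t 1) => ?; case: (leP u 1) => ?; rewrite ?ler01;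
  case: (leP 0 t) => ?; case: (leP 0 u) => ?; apply/andP; split; lra.
Qed.

Lemma clamp01_continuous : continuous clamp01.
Proof.
move=> t; apply: (@continuous_max R R (fun=> 0) (Num.min^~ 1)); first exact: cvg_cst.
by apply: (@continuous_min R R id (fun=> 1)); [exact: cvg_id|exact: cvg_cst].
Qed.

Lemma clamp01_within (T : topologicalType) (p : R -> T) :
  {within @I01 R, continuous p} -> continuous (p \o clamp01).
Proof.
move=> cp; apply/continuous_subspace_setT.
apply: (within_comp cp); first by apply: continuous_subspaceT; exact: clamp01_continuous.
by move=> t _; exact: clamp01_I01.
Qed.

End clamp.

Section lifting.
Variables (R : realType) (Y : topologicalType) (V : normedModType R).
Variable (Phi : Y -> V).
Hypothesis cY : compact [set: Y].
Hypothesis cPhi : continuous Phi.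
Hypothesis iPhi : injective Phi.

Local Notation D u v := (`|Phi u - Phi v|).
Local Notation "'I' t" := (@I01 R t) (at level 10).

Variables (f : Y -> Y) (dl rho : R).
Hypothesis dl0 : 0 < dl.
Hypothesis fE : forall u v, D u v < dl -> 2 * D u v <= D (f u) (f v).
Hypothesis rho0 : 0 < rho <= dl.
Hypothesis fO : forall u z, D (f u) z < rho -> exists2 u', f u' = z & D u u' < dl / 4.

(** Oscillation at the fixed scale [1 / (N + 1)]: lifting keeps [N] and divides [e] by 2, so the
    same subdivision serves all iterates. *)
Definition path_modulus (al : R -> Y) (N : nat) (e : R) :=
  forall t u, I t -> I u -> `|t - u| <= N.+1%:R^-1 -> D (al t) (al u) <= e.

(** The lift is extended one subinterval at a time. Continuity is not part of the induction; the
    last clause, obtained from [fE], implies it. *)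
Lemma lift_steps (al : R -> Y) (N : nat) (e : R) (x : Y) :
  e < rho -> path_modulus al N e -> f x = al 0 ->
  forall k, (k <= N.+1)%N -> exists p : R -> Y, [/\ p 0 = x,
    forall t, 0 <= t <= k%:R / N.+1%:R -> f (p t) = al t &
    forall t u, 0 <= t <= k%:R / N.+1%:R -> 0 <= u <= k%:R / N.+1%:R ->
      `|t - u| <= N.+1%:R^-1 -> 2 * D (p t) (p u) <= D (al t) (al u)].
Proof.
move=> er mal fx; elim=> [_|k IH kN].
  exists (fun=> x); split => //; rewrite mul0r.
    by move=> t ht; have -> : t = 0 by apply/eqP; rewrite eq_le andbC.
  by move=> t u _ _ _; rewrite subrr normr0 mulr0.
have [p [p0 fp mp]] := IH (ltnW kN).
set h := N.+1%:R^-1; rewrite -/h in mp fp.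
have h0 : 0 < h by rewrite invr_gt0.
have kh0 : 0 <= k%:R * h by rewrite mulr_ge0 // ltW.
have kh1 : k%:R * h + h <= 1.
  by rewrite -{2}[h]mul1r -mulrDl natr1 ler_pdivrMr ?ltr0n// mul1r ler_nat.
have kS : k.+1%:R * h = k%:R * h + h by rewrite -natr1 mulrDl mul1r.
set tk := k%:R * h in mp fp kh0 kh1 kS *.
(* On the new subinterval preimages are picked pointwise within [dl / 4] of [p tk]; expansion will
   force these choices to fit together. *)
have /choice[q qP] : forall t, exists u, tk <= t <= tk + h ->
    f u = al t /\ D (p tk) u < dl / 4.
  move=> t; have [/andP[t1 t2]|] := boolP (tk <= t <= tk + h); last by exists x.
  have [|u fu pu] := fO (u := p tk) (z := al t); last by exists u.
  rewrite fp; last by rewrite kh0 lexx.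
  apply: le_lt_trans er; apply: mal; rewrite /I01 /=.
  - by apply/andP; split; lra.
  - by apply/andP; split; lra.
  - by rewrite ler_norml -/h; apply/andP; split; lra.
rewrite kS; pose r t := if t <= tk then p t else q t.
have fr t : 0 <= t <= tk + h -> f (r t) = al t.
  move=> /andP[t0 t1]; rewrite /r; have [tt|tt] := leP t tk.
    by apply: fp; rewrite t0.
  by apply: (qP t _).1; rewrite t1 ltW.
exists r; split; first by rewrite /r kh0.
  exact: fr.
(* Doubling applies as soon as the two lifted points are within [dl]: the old part contributes less
   than [dl / 2], each chosen preimage less than [dl / 4]. *)
suff W t u : t <= u -> 0 <= t <= tk + h -> 0 <= u <= tk + h -> `|t - u| <= h ->
    D (r t) (r u) < dl.
  move=> t u It Iu tu; rewrite -(fr t)// -(fr u)//; apply: fE.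
  have [le|/ltW le] := leP t u; first exact: W.
  by rewrite distrC; apply: W => //; rewrite distrC.
move=> le /andP[t0 t1] /andP[u0 u1] tu.
have [e0 tue] : 0 <= e /\ t - u <= h.
  split; last by apply: le_trans tu; rewrite ler_norm.
  apply: le_trans (mal 0 0 _ _ _); rewrite ?normr_ge0 ?subrr ?normr0 ?invr_ge0//;
    by rewrite /I01 /= lexx ler01.
move: tu; rewrite ler_norml => /andP[tu1 tu2]; have /andP[_ rd] := rho0.
rewrite /r; have [tt|tt] := leP t tk; have [ut|ut] := leP u tk; try lra.
- have := mp t u; rewrite t0 tt u0 ut => /(_ isT isT).
  rewrite ler_norml tu1 tu2 => /(_ isT).
  have : D (al t) (al u) <= e.
    by apply: mal; rewrite /I01 /=; try (apply/andP; split; lra);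
      rewrite ler_norml -/h; apply/andP; split; lra.
  lra.
- have := mp t tk; rewrite t0 tt kh0 lexx => /(_ isT isT).
  have -> : `|t - tk| <= h by rewrite ler_norml; apply/andP; split; lra.
  move=> /(_ isT).
  have : D (al t) (al tk) <= e.
    by apply: mal; rewrite /I01 /=; try (apply/andP; split; lra);
      rewrite ler_norml -/h; apply/andP; split; lra.
  have [|_] := qP u; first by apply/andP; split; lra.
  have := pullback_dist_tri Phi (p t) (p tk) (q u); lra.
- have [|_ h1] := qP t; first by apply/andP; split; lra.
  have [|_ h2] := qP u; first by apply/andP; split; lra.
  have := pullback_dist_tri Phi (q t) (p tk) (q u).
  rewrite (distrC (Phi (q t)) (Phi (p tk))); lra.
Qed.

Lemma lift1 (al : R -> Y) (N : nat) (e : R) (x : Y) :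
  continuous al -> e < rho -> path_modulus al N e -> f x = al 0 ->
  exists p : R -> Y, [/\ continuous p, p 0 = x, forall t, I t -> f (p t) = al t &
    path_modulus p N (e / 2)].
Proof.
move=> cal er mal fx.
have [p [p0 fp mp]] := lift_steps er mal fx (leqnn _).
rewrite divff ?pnatr_eq0// in fp mp.
exists (p \o @clamp01 R); split.
- apply: (pullback_continuous cY cPhi iPhi) => t; apply/cvgrPdist_lt => ep ep0.
  have cl : continuous (Phi \o al \o @clamp01 R).
    move=> u; apply: continuous_comp; first exact: clamp01_continuous.
    by apply: continuous_comp; [exact: cal|exact: cPhi].
  have /cvgrPdist_lt/(_ ep ep0) H1 := cl t.
  have h0 : 0 < N.+1%:R^-1 :> R by rewrite invr_gt0.
  have /cvgrPdist_lt/(_ _ h0) H2 := @cvg_id R (nbhs t).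
  apply: filterS2 H1 H2 => u /= h1 h2.
  have := mp (clamp01 t) (clamp01 u) (clamp01_I01 t) (clamp01_I01 u).
  move=> /(_ (le_trans (clamp01_dist _ _) (ltW h2))).
  have := normr_ge0 (Phi (p (clamp01 t)) - Phi (p (clamp01 u))); lra.
- by rewrite /= clamp01_id // /I01 /= lexx ler01.
- by move=> t It; rewrite /= clamp01_id// fp.
- move=> t u It Iu tu; rewrite /= !clamp01_id//.
  by have := mp t u It Iu tu; have := mal t u It Iu tu; lra.
Qed.

(** The path is lifted through [f^i] starting at [f x], then once more through [f] starting at [x];
    each step halves the modulus. *)
Lemma lift_iter i : forall (al : R -> Y) (N : nat) (e : R) (x : Y),
  continuous al -> 0 <= e < rho -> path_modulus al N e -> iter i f x = al 0 ->
  exists p : R -> Y, [/\ continuous p, p 0 = x,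
    forall t, I t -> iter i f (p t) = al t & path_modulus p N (e / 2 ^+ i)].
Proof.
elim: i => [|i IH] al N e x cal /andP[e0 er] mal fx.
  by exists al; split => //; rewrite expr0 divr1.
have [||p [cp p0 fp mp]] := IH al N e (f x) cal _ mal; rewrite -?iterSr// ?e0//.
have [||q [cq q0 fq mq]] := lift1 cp _ mp (x := x) => //.
  apply: le_lt_trans er; rewrite ler_pdivrMr ?exprn_gt0//.
  by rewrite ler_peMr// exprn_ege1// ler1n.
exists q; split => //.
- by move=> t It; rewrite iterSr fq // fp.
- by rewrite exprSr invfM mulrA mulrAC in mq *.
Qed.

Lemma path_modulus_exists (al : R -> Y) e : continuous al -> 0 < e ->
  exists N, path_modulus al N e.
Proof.
move=> cal e0.
have cq : continuous (Phi \o al).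
  by move=> t; apply: continuous_comp; [exact: cal|exact: cPhi].
have cI : compact (@I01 R).
  have -> : @I01 R = `[0, 1]%classic by apply/seteqP; split => t; rewrite /= in_itv.
  exact: segment_compact.
have [eta eta0 H] := compact_uniform_continuous cI cq e0.
have [N /= HN] : exists N : nat, N.+1%:R^-1 < eta.
  exists (Num.truncn eta^-1); rewrite invf_plt ?posrE// truncnS_gt//.
exists N => t u It Iu tu; apply/ltW/H => //.
by rewrite -ball_normE /=; apply: le_lt_trans HN.
Qed.

(* By the intermediate value theorem: the distance between the two paths never
   takes values in [dl / 2, dl[. *)
Lemma lifts_close1 (p q : R -> Y) (t0 : R) : continuous p -> continuous q ->
  I t0 -> p t0 = q t0 -> (forall t, I t -> D (f (p t)) (f (q t)) < dl) ->
  forall t, I t -> D (p t) (q t) <= D (f (p t)) (f (q t)).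
Proof.
move=> cp cq It0 e0 close t It.
have [v0 v1 v2] : [/\ 0 <= dl * 3 / 4, dl * 3 / 4 < dl & dl / 2 < dl * 3 / 4].
  by have := dl0; split; lra.
pose th s := D (p s) (q s).
have cth : continuous th.
  move=> s; apply: cvg_norm; apply: cvgB; apply: continuous_comp;
    [exact: cp|exact: cPhi|exact: cq|exact: cPhi].
have E s : I s -> th s < dl -> th s < dl / 2.
  by move=> Is /fE h; have := close s Is; rewrite /th; lra.
suff lt : th t < dl.
  by have := fE lt; have := normr_ge0 (Phi (p t) - Phi (q t)); lra.
rewrite ltNge; apply/negP => ge.
have tht0 : th t0 = 0 by rewrite /th e0 subrr normr0.
have Ex : exists2 c, I c & th c = dl * 3 / 4.
  move: It It0 => /andP[t0' t1] /andP[t00 t01].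
  have [le|/ltW le] := leP t t0.
    have [||c ch <-] := IVT (f := th) (v := dl * 3 / 4) le; last 1 first.
    - exists c => //; move: ch; rewrite in_itv /= => /andP[? ?].
      by apply/andP; split; lra.
    - exact: continuous_subspaceT.
    - by rewrite ge_min le_max tht0 v0 orbT (le_trans (ltW v1) ge).
  have [||c ch <-] := IVT (f := th) (v := dl * 3 / 4) le; last 1 first.
  - exists c => //; move: ch; rewrite in_itv /= => /andP[? ?].
    by apply/andP; split; lra.
  - exact: continuous_subspaceT.
  - by rewrite ge_min le_max tht0 v0 (le_trans (ltW v1) ge) orbT.
case: Ex => c Ic ec; have := E c Ic; rewrite ec => /(_ v1).
by rewrite ltNge => /negP; apply; exact: ltW.
Qed.

Hypothesis cf : continuous f.

Lemma iter_continuous i : continuous (iter i f).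
Proof.
elim: i => [|i IH] y; first exact: cvg_id.
by apply: continuous_comp; [exact: IH|exact: cf].
Qed.

(** Only the images under [f^i] are assumed close. The bound descends one power at a time: applied
    to [f \o p] and [f \o q], it supplies the closeness required by [lifts_close1]. *)
Lemma lifts_close i : forall (p q : R -> Y) (t0 : R), continuous p -> continuous q ->
  I t0 -> p t0 = q t0 ->
  (forall t, I t -> D (iter i f (p t)) (iter i f (q t)) < dl) ->
  forall t, I t -> D (p t) (q t) <= D (iter i f (p t)) (iter i f (q t)).
Proof.
elim: i => [//|i IH] p q t0 cp cq It0 e0 close.
have := IH (f \o p) (f \o q) t0; rewrite /= e0 -?iterSr => H.
have H' t : I t -> D (f (p t)) (f (q t)) <=
    D (iter i.+1 f (p t)) (iter i.+1 f (q t)).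
  rewrite !iterSr; apply: H => //.
  - by move=> s; apply: continuous_comp; [exact: cp|exact: cf].
  - by move=> s; apply: continuous_comp; [exact: cq|exact: cf].
  - by move=> s Is; rewrite -!iterSr; exact: close.
move=> t It; apply: le_trans (H' t It).
apply: lifts_close1 It0 e0 _ t It => // s Is.
exact: le_lt_trans (H' s Is) (close s Is).
Qed.

Lemma lifts_eq i (p q : R -> Y) (t0 : R) : continuous p -> continuous q ->
  I t0 -> p t0 = q t0 ->
  (forall t, I t -> iter i f (p t) = iter i f (q t)) ->
  forall t, I t -> p t = q t.
Proof.
move=> cp cq It0 e0 eq t It; apply/iPhi/eqP; rewrite -subr_eq0 -normr_le0.
apply: le_trans (lifts_close (i := i) cp cq It0 e0 _ It) _.
  by move=> s Is; rewrite eq// subrr normr0.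
by rewrite eq// subrr normr0.
Qed.

End lifting.

(** * Monodromy: homotopic paths have lifts with the same endpoint *)

Section monodromy.
Variables (R : realType) (Y : topologicalType) (V : normedModType R).
Variable (Phi : Y -> V).
Hypothesis cY : compact [set: Y].
Hypothesis cPhi : continuous Phi.
Hypothesis iPhi : injective Phi.

Local Notation D u v := (`|Phi u - Phi v|).
Local Notation "'I' t" := (@I01 R t) (at level 10).

(** Stated for plain functions based at [p 0] rather than for [loop], because the closed lifts are
    based at varying points. *)
Definition null_homotopic (p : R -> Y) := exists H : R * R -> Y,
  [/\ {within @I01 R `*` @I01 R, continuous H},
      forall t, I t -> H (0, t) = p t,
      forall t, I t -> H (1, t) = p 0 &
      forall s, I s -> H (s, 0) = p 0 /\ H (s, 1) = p 0].

(** The contraction may leave [U]; only the loop is confined to it. *)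
Definition loops_null_homotopic (U : set Y) := forall p : R -> Y, continuous p ->
  (forall t, I t -> U (p t)) -> p 1 = p 0 -> null_homotopic p.

(** A chain of at most [N + 1] steps, each of size at most [e], joins [p 0] to [p t]. *)
Lemma path_modulus_diam (p : R -> Y) N e : path_modulus Phi p N e ->
  forall t, I t -> D (p 0) (p t) <= N.+1%:R * e.
Proof.
move=> mp; set h := N.+1%:R^-1 : R.
have h0 : 0 < h by rewrite invr_gt0.
have e0 : 0 <= e.
  apply: le_trans (mp 0 0 _ _ _); rewrite ?normr_ge0 ?subrr ?normr0 ?invr_ge0//;
    by rewrite /I01 /= lexx ler01.
have W k : forall t, I t -> t <= k%:R * h -> D (p 0) (p t) <= k%:R * e.
  elim: k => [|k IH] t /andP[t0 t1] tk.
    have -> : t = 0 by apply/eqP; rewrite eq_le t0 -[X in _ <= X](mul0r h) tk.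
    by rewrite subrr normr0 mul0r.
  have [le|/ltW le] := leP t (k%:R * h).
    apply: le_trans (IH t _ le) _; first by apply/andP.
    by rewrite ler_wpM2r// ler_nat.
  have kh0 : 0 <= k%:R * h by rewrite mulr_ge0 // ltW.
  have Ik : I (k%:R * h) by apply/andP; split => //; lra.
  have h1 := IH _ Ik (lexx _).
  have h2 : D (p (k%:R * h)) (p t) <= e.
    apply: mp => //; first by apply/andP.
    by move: tk; rewrite -natr1 mulrDl mul1r ler_norml -/h => ?;
      apply/andP; split; lra.
  have := pullback_dist_tri Phi (p 0) (p (k%:R * h)) (p t).
  rewrite -natr1 mulrDl mul1r; lra.
move=> t It; apply: W => //; rewrite divff ?pnatr_eq0//.
by case/andP: It.
Qed.

Section lifts.
Variables (f : Y -> Y) (dl rho : R).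
Hypothesis dl0 : 0 < dl.
Hypothesis fE : forall u v, D u v < dl -> 2 * D u v <= D (f u) (f v).
Hypothesis rho0 : 0 < rho <= dl.
Hypothesis fO : forall u z, D (f u) z < rho -> exists2 u', f u' = z & D u u' < dl / 4.
Hypothesis cf : continuous f.

Lemma lift_exists i (al : R -> Y) (x : Y) : continuous al -> iter i f x = al 0 ->
  exists p : R -> Y, [/\ continuous p, p 0 = x &
    forall t, I t -> iter i f (p t) = al t].
Proof.
move=> cal fx; have r2 : 0 < rho / 2 by case/andP: rho0 => *; lra.
have [N mN] := path_modulus_exists cPhi cal r2.
have [|p [cp p0 fp _]] := lift_iter cY cPhi iPhi fE rho0 fO cal _ mN fx.
  by case/andP: rho0 => *; apply/andP; split; lra.
by exists p.
Qed.

(** The homotopy itself is not lifted, only its slices at the times [k%:R * h]. Neighbouring slices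
    are uniformly close, so [lifts_close] bounds the distance of the endpoints of their lifts by the
    distance of the endpoints downstairs, which is 0. *)
Lemma lift_monodromy i (H : R * R -> Y) (p0 p1 : R -> Y) : continuous H ->
  (forall s, I s -> H (s, 0) = H (0, 0)) -> (forall s, I s -> H (s, 1) = H (0, 1)) ->
  continuous p0 -> continuous p1 -> p0 0 = p1 0 ->
  (forall t, I t -> iter i f (p0 t) = H (0, t)) ->
  (forall t, I t -> iter i f (p1 t) = H (1, t)) -> p0 1 = p1 1.
Proof.
move=> cH H0 H1 cp0 cp1 p01 fp0 fp1.
have I0 : I 0 by rewrite /I01 /= lexx ler01.
have I1 : I 1 by rewrite /I01 /= lexx ler01.
have cq : continuous (Phi \o H).
  by move=> t; apply: continuous_comp; [exact: cH|exact: cPhi].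
have cI : compact (@I01 R).
  have -> : @I01 R = `[0, 1]%classic by apply/seteqP; split => t; rewrite /= in_itv.
  exact: segment_compact.
have [eta eta0 close] := compact_uniform_continuous (compact_setX cI cI) cq dl0.
have [K HK] : exists K : nat, K.+1%:R^-1 < eta.
  by exists (Num.truncn eta^-1); rewrite invf_plt ?posrE// truncnS_gt.
set h := K.+1%:R^-1 in HK; have h0 : 0 < h by rewrite invr_gt0.
have cHs s : continuous (fun t => H (s, t)).
  move=> t; apply: (@continuous_comp R (R * R)%type Y (fun t => (s, t)) H); last exact: cH.
  by apply: (@pair_continuous _ _ _ (fun=> s) id) => u; [exact: cvg_cst|exact: cvg_id].
have W k : (k <= K.+1)%N -> exists p : R -> Y, [/\ continuous p, p 0 = p0 0, p 1 = p0 1 &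
    forall t, I t -> iter i f (p t) = H (k%:R * h, t)].
  elim: k => [_|k IH kK]; first by exists p0; split => //; rewrite mul0r.
  have [p [cp pe0 pe1 fp]] := IH (ltnW kK).
  have Ikh j : (j <= K.+1)%N -> I (j%:R * h).
    move=> jK; rewrite /I01 /= mulr_ge0// ?(ltW h0)//=.
    by rewrite ler_pdivrMr ?ltr0n// mul1r ler_nat.
  have [|q [cq' q0 fq]] := lift_exists (i := i) (x := p0 0) (cHs (k.+1%:R * h)).
    by rewrite H0 ?fp0//; exact: Ikh.
  exists q; split => //; rewrite -pe1; apply/iPhi/esym/eqP.
  rewrite -subr_eq0 -normr_le0.
  apply: le_trans (lifts_close cPhi dl0 fE cf (i := i) cp cq' I0 _ _ I1) _; first 2 last.
  - by rewrite fp// fq// !H1 ?subrr ?normr0//; apply: Ikh => //; exact: ltnW.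
  - by rewrite q0.
  move=> t It; rewrite fp// fq//; apply: close; first by split => //; apply: Ikh; exact: ltnW.
  split => /=; last exact: ballxx.
  rewrite -ball_normE /= -natr1 mulrDl mul1r opprD addrA subrr add0r normrN gtr0_norm//.
have [p [cp pe0 pe1 fp]] := W K.+1 (leqnn _).
(* The last slice is [H (1, _)], of which [p1] is a lift with the same starting point. *)
rewrite -pe1; apply: (lifts_eq cPhi iPhi dl0 fE cf cp cp1 I0 _ _ I1 (i := i)).
  by rewrite pe0.
by move=> t It; rewrite fp// fp1// divff ?pnatr_eq0.
Qed.

End lifts.
End monodromy.

(** * Small closed lifts of loops conjugate into iterated images *)

Section conjugate.
Variables (R : realType) (Y : topologicalType) (V : normedModType R).
Variable (Phi : Y -> V).
Hypothesis cY : compact [set: Y].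
Hypothesis cPhi : continuous Phi.
Hypothesis iPhi : injective Phi.

Local Notation D u v := (`|Phi u - Phi v|).
Local Notation "'I' t" := (@I01 R t) (at level 10).

Lemma homotopy_clamp (y0 : Y) (f g : loop R y0) : homotopic f g ->
  exists H : R * R -> Y, [/\ continuous H,
    forall t, I t -> H (0, t) = f t, forall t, I t -> H (1, t) = g t &
    forall s, I s -> H (s, 0) = y0 /\ H (s, 1) = y0].
Proof.
case=> H [cH H0 H1 Hy]; pose c2 (x : R * R) := (clamp01 x.1, clamp01 x.2).
have I0 : I 0 by rewrite /I01 /= lexx ler01.
have I1 : I 1 by rewrite /I01 /= lexx ler01.
exists (H \o c2); split; rewrite /c2 /=.
- apply/continuous_subspace_setT; apply: (within_comp cH); last first.
    by move=> x _; split; exact: clamp01_I01.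
  apply: continuous_subspaceT; apply: pair_continuous => x.
    by apply: continuous_comp; [exact: cvg_fst|exact: clamp01_continuous].
  by apply: continuous_comp; [exact: cvg_snd|exact: clamp01_continuous].
- by move=> t It; rewrite !clamp01_id// H0.
- by move=> t It; rewrite !clamp01_id// H1.
- by move=> s Is; rewrite !clamp01_id//; exact: Hy.
Qed.

Variable f : Y -> Y.
Hypothesis cf : continuous f.
Hypothesis opf : forall (y : Y) (U : set Y), nbhs y U -> nbhs (f y) (f @` U).
Hypothesis ef : forall y : Y, exists2 U : set Y, nbhs y U &
  forall u v, U u -> U v -> 2 * D u v <= D (f u) (f v).
Hypothesis nf : forall y : Y, exists2 U : set Y, nbhs y U & @loops_null_homotopic R Y U.

(* Since [al] is conjugate to [f^i o be], one of its lifts through [f^i] is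
   closed; as [i] grows these closed lifts become arbitrarily small. *)
Lemma homotopic_iter_trivial (y0 : Y) (al : loop R y0) : f y0 = y0 ->
  (forall i, exists ga be ze : loop R y0,
    (forall t, I t -> ze t = iter i f (be t)) /\
    homotopic (concat al ga) (concat ga ze)) ->
  homotopic al (const_loop R y0).
Proof.
move=> fy0 conj.
have I0 : I 0 by rewrite /I01 /= lexx ler01.
have I1 : I 1 by rewrite /I01 /= lexx ler01.
have ify0 i : iter i f y0 = y0 by elim: i => //= i ->.
have [dl dl0 fE] := uniform_expansion cY cPhi iPhi ef.
have [|rho' rho'0 fO'] := uniform_openness cY cPhi iPhi cf opf (eta := dl / 4).
  by lra.
(* The lifting lemmas require [rho <= dl]. *)
pose rho := Num.min rho' dl.
have rho0 : 0 < rho <= dl by rewrite /rho lt_min rho'0 dl0 ge_min lexx orbT.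
have fO u z : D (f u) z < rho -> exists2 u', f u' = z & D u u' < dl / 4.
  by rewrite /rho lt_min => /andP[? _]; exact: fO'.
(* A size valid at every centre, since the base point of the closed lift is not known in advance. *)
have [ep ep0 small] : exists2 ep, 0 < ep & forall y, exists2 U,
    @loops_null_homotopic R Y U & forall z, D y z < ep -> U z.
  apply: (pullback_lebesgue cY (P := fun (ep : R) (y : Y) => exists2 U,
    @loops_null_homotopic R Y U & forall z, D y z < ep -> U z)).
    move=> e e' u /andP[_ ee'] [U nU H]; exists U => // z uz; apply: H; lra.
  move=> y; have [U yU nU] := nf y.
  have [e e0 H] := pullback_nbhs_uniform cY cPhi iPhi yU.
  by exists e => //; apply: filterS H => u ?; exists U.
have cal := clamp01_within (loop_continuous al).
have e0 : 0 < rho / 2 by case/andP: rho0 => *; lra.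
have [N mN] := path_modulus_exists cPhi cal e0.
(* [N] depends on [al] alone, so [i] can be chosen after it. *)
have [i smalli] : exists i, N.+1%:R * (rho / 2 / 2 ^+ i) < ep.
  have /cvgrPdist_lt/(_ ep ep0)[i _ /(_ i (leqnn i))] :
      (geometric (N.+1%:R * (rho / 2)) 2^-1 : R ^nat) @ \oo --> (0 : R).
    by apply: cvg_geometric; rewrite gtr0_norm; lra.
  rewrite /= sub0r normrN => H; exists i; apply: le_lt_trans H.
  by rewrite exprVn mulrA; exact: ler_norm.
have [ga [be [ze [zeE /homotopy_clamp[H [cH H0 H1 Hy]]]]]] := conj i.
have cga := clamp01_within (loop_continuous ga).
have cbe := clamp01_within (loop_continuous be).
have lift (p : R -> Y) x : continuous p -> iter i f x = p 0 ->
    exists q, [/\ continuous q, q 0 = x & forall t, I t -> iter i f (q t) = p t].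
  exact: (lift_exists cY cPhi iPhi fE rho0 fO).
have uniq (p q : R -> Y) t0 : continuous p -> continuous q -> I t0 -> p t0 = q t0 ->
    (forall t, I t -> iter i f (p t) = iter i f (q t)) -> forall t, I t -> p t = q t.
  exact: (lifts_eq cPhi iPhi dl0 fE cf).
have caff (p : R -> Y) (a b : R) : continuous p -> continuous (fun t => p (a * t + b)).
  move=> cp t; apply: (@continuous_comp R R Y (fun t => a * t + b) p); last exact: cp.
  exact: affine_continuous.
have cH_ s : continuous (fun t => H (s, t)).
  move=> t; apply: (@continuous_comp R (R * R)%type Y (fun t => (s, t)) H); last exact: cH.
  by apply: (@pair_continuous _ _ _ (fun=> s) id) => u; [exact: cvg_cst|exact: cvg_id].
(* The lift of [ga] that ends at [y0] is wanted; it is the reverse of a lift of the reversed path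
   starting at [y0]. Its initial point [x] is where [al] will lift to a closed path. *)
have [||r [cr r0 fr]] := lift (fun t => ga (clamp01 (-1 * t + 1))) y0.
- exact: caff cga.
- by rewrite mulr0 add0r clamp01_id// loop1 ify0.
pose pga t := r (-1 * t + 1).
have cpga : continuous pga by exact: caff.
have fpga t : I t -> iter i f (pga t) = ga t.
  move=> /andP[t0 t1]; have It : I (-1 * t + 1) by apply/andP; split; lra.
  by rewrite /pga fr// clamp01_id; [congr (ga _); lra|apply/andP; split; lra].
have pga1 : pga 1 = y0 by rewrite /pga -r0; congr r; lra.
set x := pga 0.
have fx : iter i f x = y0 by rewrite /x fpga// loop0.
have [||pal [cpal pal0 fpal mpal]] := lift_iter cY cPhi iPhi fE rho0 fO cal _ mN (i := i) (x := x).
- by case/andP: rho0 => *; apply/andP; split; lra.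
- by rewrite /= clamp01_id// loop0.
have [|P0 [cP0 P00 fP0]] := lift (fun t => H (0, t)) x (cH_ 0).
  by rewrite (Hy 0 I0).1.
have [|P1 [cP1 P10 fP1]] := lift (fun t => H (1, t)) x (cH_ 1).
  by rewrite (Hy 1 I1).1.
have P01 : P0 1 = P1 1.
  apply: (lift_monodromy cY cPhi iPhi dl0 fE rho0 fO cf cH _ _ cP0 cP1 _ fP0 fP1).
  - by move=> s Is; rewrite (Hy s Is).1 (Hy 0 I0).1.
  - by move=> s Is; rewrite (Hy s Is).2 (Hy 0 I0).2.
  - by rewrite P00.
have half1 t : I t -> I (2^-1 * t + 0) /\ 2 * (2^-1 * t + 0) = t.
  by move=> /andP[t0 t1]; split; [apply/andP; split; lra|lra].
have half2 t : I t -> I (2^-1 * t + 2^-1) /\ 2 * (2^-1 * t + 2^-1) - 1 = t.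
  by move=> /andP[t0 t1]; split; [apply/andP; split; lra|lra].
have concat1 (p q : loop R y0) t : I t -> concat p q (2^-1 * t + 0) = p t.
  move=> It; have [_ e] := half1 t It; rewrite /= /concat_fun e ifT//.
  by case/andP: It => *; lra.
have concat2 (p q : loop R y0) t : I t -> concat p q (2^-1 * t + 2^-1) = q t.
  move=> It; have [_ e] := half2 t It; rewrite /= /concat_fun e; case: ifP => // le.
  (* At the junction [concat] still uses its first path, whose end is the start of the second. *)
  have -> : t = 0 by case/andP: It => *; lra.
  by have -> : 2 * (2^-1 * 0 + 2^-1) = 1 :> R; [lra|rewrite loop0 loop1].
(* [P1] lifts [ga] followed by [ze]; its first half starts at [x], hence is [pga]. *)
have P1half : P1 2^-1 = y0.
  rewrite -pga1.
  have := uniq (fun t => P1 (2^-1 * t + 0)) pga 0 (caff _ _ _ cP1) cpga I0.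
  rewrite mulr0 addr0 P10 => /(_ erefl) E; rewrite -(E _ 1 I1).
    by congr P1; lra.
  by move=> t It; rewrite fpga// fP1 ?H1 ?concat1//; exact: (half1 t It).1.
(* The second half lifts [ze] from [y0], hence is [be], a closed path. This is where [ze] being an
   image under [f^i] matters. *)
have P11 : P1 1 = y0.
  have := uniq (fun t => P1 (2^-1 * t + 2^-1)) (be \o @clamp01 R) 0 (caff _ _ _ cP1) cbe I0.
  rewrite mulr0 add0r P1half /= clamp01_id// loop0 => /(_ erefl) E.
  have E' : P1 (2^-1 * 1 + 2^-1) = be (clamp01 1).
    apply: E => // t It; rewrite fP1 ?H1 ?concat2 ?zeE ?clamp01_id//;
      exact: (half2 t It).1.
  by move: E'; rewrite clamp01_id// loop1 => <-; congr P1; lra.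
(* [P0] lifts [al] followed by [ga] and also ends at [y0]; uniqueness, now anchored at time 1,
   identifies its second half with [pga]. *)
have P0half : P0 2^-1 = x.
  have := uniq (fun t => P0 (2^-1 * t + 2^-1)) pga 1 (caff _ _ _ cP0) cpga I1.
  have -> : 2^-1 * 1 + 2^-1 = 1 :> R by lra.
  rewrite P01 P11 pga1 => /(_ erefl) E; rewrite /x -E//.
    by rewrite mulr0 add0r.
  by move=> t It; rewrite fpga// fP0 ?H0 ?concat2//; exact: (half2 t It).1.
have pal1 : pal 1 = pal 0.
  have := uniq (fun t => P0 (2^-1 * t + 0)) pal 0 (caff _ _ _ cP0) cpal I0.
  rewrite pal0 mulr0 addr0 P00 => /(_ erefl) E; rewrite -(E _ 1 I1).
    by rewrite -P0half; congr P0; lra.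
  move=> t It; rewrite fpal// fP0 ?H0 ?concat1 /= ?clamp01_id//;
    exact: (half1 t It).1.
have [U nU xU] := small (pal 0).
have [|K [cK K0 K1 Kx]] := nU pal cpal _ pal1.
  by move=> t It; apply/xU/le_lt_trans/smalli/(path_modulus_diam mpal).
(* Composition with [f^i] sends the base point [x] to [y0], so the pushed homotopy fixes the
   endpoints. *)
exists (iter i f \o K); split => /=.
- apply: (within_comp (B := setT) _ cK) => //.
  exact/continuous_subspaceT/iter_continuous.
- by move=> t It; rewrite K0// fpal//= clamp01_id.
- by move=> t It; rewrite K1// pal0.
- by move=> s Is; have [-> ->] := Kx s Is; rewrite pal0.
Qed.

End conjugate.

(** * Strict differentiability *)

Section matrix_norm.
Variable R : realType.

Lemma mx_entry_norm_le m n (A : 'M[R]_(m, n)) i j : `|A i j| <= `|A|.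
Proof.
rewrite -[leRHS]/(mx_norm A) mx_normrE.
exact: (le_bigmax _ (fun ij : 'I_m * 'I_n => `|A ij.1 ij.2|) (i, j)).
Qed.

Lemma mx_norm_le m n (A : 'M[R]_(m, n)) e : 0 <= e ->
  (forall i j, `|A i j| <= e) -> `|A| <= e.
Proof.
move=> e0 Ae; have [/eqP A0|/mx_norm_neq0[ij nA]] := eqVneq (mx_norm A) 0.
  by rewrite -[leLHS]/(mx_norm A) (eqP A0).
by rewrite -[leLHS]/(mx_norm A) nA.
Qed.

(** The norm is the largest modulus of an entry, and an entry of the product is a sum of [n] terms;
    hence the factor [n]. *)
Lemma mulmx_norm_le n m (v : 'rV[R]_n) (J : 'M[R]_(n, m)) :
  `|v *m J| <= n%:R * `|J| * `|v|.
Proof.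
apply: mx_norm_le => [|i j]; first by rewrite !mulr_ge0.
rewrite mxE; apply: le_trans (ler_norm_sum _ _ _) _.
have -> : n%:R * `|J| * `|v| = \sum_(k < n) `|v| * `|J|.
  by rewrite sumr_const card_ord -mulr_natl; ring.
apply: ler_sum => k _; rewrite normrM.
by apply: ler_pM => //; exact: mx_entry_norm_le.
Qed.

End matrix_norm.

Lemma nbhs_norm_lt (R : realType) (V : normedModType R) (x : V) (U : set V) :
  nbhs x U <-> exists2 r, 0 < r & forall a, `|a - x| < r -> U a.
Proof.
split=> [/nbhs_ballP|] [r r0 H].
  by exists r => // a ar; apply: H; rewrite -ball_normE /= distrC.
by apply/nbhs_ballP; exists r => // a; rewrite -ball_normE /= distrC; exact: H.
Qed.

Lemma norm_continuous_at (R : realType) (V W : normedModType R) (F : V -> W) a :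
  (forall e, 0 < e -> exists2 s, 0 < s &
    forall b, `|a - b| < s -> `|F a - F b| < e) -> {for a, continuous F}.
Proof.
move=> H; apply/cvgrPdist_lt => e /H[s s0 Hs]; apply/nbhs_ballP.
by exists s => // b; rewrite -ball_normE; exact: Hs.
Qed.

Lemma finite_continuous_near (R : realType) (V W : normedModType R) (I : finType)
    (G : I -> V -> W) (U : set V) x e : open U -> U x ->
  (forall i, {for x, continuous (G i)}) -> 0 < e ->
  exists2 r, 0 < r & forall y, `|y - x| < r -> U y /\ forall i, `|G i x - G i y| < e.
Proof.
move=> oU Ux cG e0.
have : \forall y \near x, U y /\ forall i, `|G i x - G i y| < e.
  apply: filterI; first by apply: open_nbhs_nbhs.
  apply: filter_forall => i.
  by have /cvgrPdist_lt/(_ _ e0) := cG i.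
move=> /nbhs_ballP[r /= r0 H]; exists r => // y yr; apply: H.
by rewrite -ball_normE /= distrC.
Qed.

Lemma continuous_dist (R : realType) (T : topologicalType) (V : normedModType R)
    (F : T -> V) (w : V) p :
  {for p, continuous F} -> {for p, continuous (fun q => `|F q - w| : R)}.
Proof. by move=> cF; apply: cvg_norm; apply: cvgB; [exact: cF|exact: cvg_cst]. Qed.

Lemma norm_ball_compact (R : realType) n (x : 'rV[R]_n) d :
  compact [set p | `|p - x| <= d].
Proof.
apply: bounded_closed_compact.
  exists (`|x| + d); split; first exact: num_real.
  move=> M xM p /= Bp; apply/ltW/le_lt_trans/xM.
  by have := ler_normD (p - x) x; rewrite subrK; lra.
have -> : [set p | `|p - x| <= d] = (fun p => `|p - x|) @^-1` [set y | y <= d] by [].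
apply: preimage_closed; last exact: closed_le.
by move=> p _; apply: (@continuous_dist _ _ _ id); exact: cvg_id.
Qed.

Section strict_differentiability.
Variable R : realType.

(** Both points vary, unlike in differentiability at [x]; this yields Lipschitz and expansion
    estimates between arbitrary nearby points. The Jacobian acts on row vectors from the right. *)
Definition strict_diff n m (F : 'rV[R]_n -> 'rV[R]_m) (x : 'rV[R]_n) (J : 'M[R]_(n, m)) :=
  forall e, 0 < e -> exists2 r, 0 < r & forall a b, `|a - x| < r -> `|b - x| < r ->
    `|F a - F b - (a - b) *m J| <= e * `|a - b|.

Lemma strict_diff_lipschitz n m (F : 'rV[R]_n -> 'rV[R]_m) x J : strict_diff F x J ->
  exists K r, [/\ 0 < K, 0 < r & forall a b, `|a - x| < r -> `|b - x| < r ->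
    `|F a - F b| <= K * `|a - b|].
Proof.
move=> /(_ 1 ltr01)[r r0 H]; have K0 : 0 < n%:R * `|J| + 1 by rewrite ltr_wpDl// mulr_ge0.
exists (n%:R * `|J| + 1), r; split => //.
move=> a b ar br; rewrite mulrDl.
have := H a b ar br; have := mulmx_norm_le (a - b) J.
have := ler_normD (F a - F b - (a - b) *m J) ((a - b) *m J).
rewrite subrK; lra.
Qed.

Lemma strict_diff_continuous n m (F : 'rV[R]_n -> 'rV[R]_m) x J : strict_diff F x J ->
  exists2 r, 0 < r & forall a, `|a - x| < r -> {for a, continuous F}.
Proof.
move=> /strict_diff_lipschitz[K [r [K0 r0 H]]]; exists r => // a ar.
apply: norm_continuous_at => e e0.
have s0 : 0 < Num.min (e / K) (r - `|a - x|).
  by rewrite lt_min divr_gt0//= subr_gt0.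
exists (Num.min (e / K) (r - `|a - x|)) => // b; rewrite lt_min => /andP[h1 h2].
apply: le_lt_trans (H _ _ ar _) _.
  by have := ler_distD a b x; rewrite (distrC b a); lra.
by rewrite mulrC -ltr_pdivlMr.
Qed.

Lemma strict_diff_near n m (F G : 'rV[R]_n -> 'rV[R]_m) x J :
  (\forall a \near x, F a = G a) -> strict_diff F x J -> strict_diff G x J.
Proof.
move=> /nbhs_ballP[r /= r0 FG] FJ e e0; have [s s0 H] := FJ e e0.
exists (Num.min r s) => [|a b]; first by rewrite lt_min r0.
rewrite !lt_min => /andP[ar ha] /andP[br bs].
by rewrite -!FG ?H// -ball_normE /= distrC.
Qed.

Lemma strict_diff_comp n m p (F : 'rV[R]_n -> 'rV[R]_m) (G : 'rV[R]_m -> 'rV[R]_p)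
    x J1 J2 : strict_diff F x J1 -> strict_diff G (F x) J2 ->
  strict_diff (G \o F) x (J1 *m J2).
Proof.
move=> FJ GJ e e0.
have [K [r [K0 r0 lip]]] := strict_diff_lipschitz FJ.
(* Adding 1 keeps the divisor positive when [J2] is zero. *)
set K2 := m%:R * `|J2| + 1; have K20 : 0 < K2 by rewrite ltr_wpDl// mulr_ge0.
have [|s s0 HG] := GJ (e / 2 / K); first by rewrite !divr_gt0.
have [|u u0 HF] := FJ (e / 2 / K2); first by rewrite !divr_gt0.
exists (Num.min r (Num.min (s / K) u)) => [|a b].
  by rewrite !lt_min r0 u0 divr_gt0.
rewrite !lt_min => /and3P[ar ha au] /and3P[br bs bu] /=.
have sF c : `|c - x| < r -> `|c - x| < s / K -> `|F c - F x| < s.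
  move=> cr cs; apply: le_lt_trans (lip c x cr _) _; first by rewrite subrr normr0.
  by rewrite mulrC -ltr_pdivlMr.
have h1 := HG _ _ (sF a ar ha) (sF b br bs).
have h2 : `|(F a - F b - (a - b) *m J1) *m J2| <= e / 2 * `|a - b|.
  apply: le_trans (mulmx_norm_le _ _) _.
  apply: le_trans (_ : K2 * `|F a - F b - (a - b) *m J1| <= _).
    by apply: ler_wpM2r => //; rewrite /K2 lerDl.
  by rewrite mulrC -ler_pdivlMr// mulrAC; exact: HF.
have h3 : e / 2 / K * `|F a - F b| <= e / 2 * `|a - b|.
  apply: le_trans (ler_wpM2l _ (lip _ _ ar br)) _; first by rewrite !divr_ge0 ?ltW.
  by rewrite mulrA divfK ?gt_eqF.
have -> : G (F a) - G (F b) - (a - b) *m (J1 *m J2) =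
    (G (F a) - G (F b) - (F a - F b) *m J2) + (F a - F b - (a - b) *m J1) *m J2.
  by rewrite (mulmxBl (F a - F b)) -mulmxA addrA subrK.
by apply: le_trans (ler_normD _ _) _; lra.
Qed.

Lemma strict_diff_diff n m (F : 'rV[R]_n -> 'rV[R]_m) x J v : strict_diff F x J ->
  'd F x v = v *m J.
Proof.
move=> FJ; have cJ : continuous (mulmxr J : 'rV[R]_n -> 'rV[R]_m).
  move=> a; apply: norm_continuous_at => e e0.
  set K := n%:R * `|J| + 1; have K0 : 0 < K by rewrite ltr_wpDl// mulr_ge0.
  have eK : 0 < e / K by rewrite divr_gt0.
  exists (e / K) => // b ab; rewrite -mulmxBl.
  apply: le_lt_trans (mulmx_norm_le _ _) _.
  apply: le_lt_trans (_ : K * `|a - b| < _).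
    by apply: ler_wpM2r => //; rewrite /K lerDl.
  by rewrite mulrC -ltr_pdivlMr.
rewrite (@diff_unique _ _ _ F (mulmxr J) x)//.
apply/eqaddoP => e e0; have [r r0 H] := FJ e e0.
apply/nbhs_ballP; exists r => // h; rewrite -ball_normE /= sub0r normrN => hr.
have := H (h + x) x; rewrite addrK subrr normr0 => /(_ hr r0).
rewrite /cst opprD addrA /=.
by [].
Qed.

(* Mean value theorem in each coordinate. *)
Lemma C1_strict_diff n m (F : 'rV[R]_n -> 'rV[R]_m) (U : set 'rV[R]_n) x :
  open U -> U x -> Ck 1 U F -> strict_diff F x (lin1_mx ('d F x)).
Proof.
move=> oU Ux [dF cD] e e0.
pose e' := e / n.+1%:R; have e'0 : 0 < e' by rewrite divr_gt0.
have [r r0 H] := finite_continuous_near (G := fun k : 'I_n => 'D_(delta_mx 0 k) F)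
  oU Ux (fun k => cD (delta_mx 0 k) x Ux) e'0.
exists r => // a b ax bx.
set w := a - b.
have inU t : 0 <= t <= 1 -> U (b + t *: w) /\ forall k : 'I_n,
    `|'D_(delta_mx 0 k) F x - 'D_(delta_mx 0 k) F (b + t *: w)| < e'.
  move=> /andP[t0 t1]; apply: H.
  have -> : b + t *: w - x = (1 - t) *: (b - x) + t *: (a - x).
    by rewrite /w; apply/rowP => j; rewrite !mxE; ring.
  have t1' : 0 <= 1 - t by lra.
  apply: le_lt_trans (ler_normD _ _) _; rewrite !normrZ !ger0_norm//.
  have [t00|tn0] := eqVneq t 0; first by rewrite t00; lra.
  have tp : 0 < t by rewrite lt_neqAle eq_sym tn0.
  have : t * `|a - x| < t * r by rewrite ltr_pM2l.
  have : (1 - t) * `|b - x| <= (1 - t) * r by rewrite ler_wpM2l// ltW.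
  by move=> h1 h2; apply: lt_le_trans (ler_ltD h1 h2) _; rewrite -mulrDl subrK mul1r.
apply: mx_norm_le => [|i j]; first by rewrite mulr_ge0// ltW.
rewrite ord1 {i} mul_rV_lin1.
pose h (t : R) := F (b + t *: w) 0 j.
have dh (t : R) : 0 <= t <= 1 -> is_derive t 1 h ('d F (b + t *: w) w 0 j).
  move=> /inU[Ut _].
  have cv : s^-1 *: (h (s *: 1 + t) - h t) @[s --> 0^'] --> 'd F (b + t *: w) w 0 j.
    rewrite -deriveE; last exact: dF.
    have dFw : derivable F (b + t *: w) w by apply: diff_derivable; exact: dF.
    have -> : (fun s : R => s^-1 *: (h (s *: 1 + t) - h t)) = (fun s : R =>
        (s^-1 *: ((F \o shift (b + t *: w)) (s *: w) - F (b + t *: w))) 0 j).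
      by apply/funext => s; rewrite /h /= !mxE [s *: 1]mulr1 scalerDl addrCA.
    exact: (continuous_cvg _ (@matrix_normedtype.coord_continuous R 1 m 0 j _) dFw).
  by split; [apply/cvg_ex; eexists; exact: cv|exact: cvg_lim cv].
have [||c] := @MVT R h (fun t => 'd F (b + t *: w) w 0 j) 0 1 ltr01.
- move=> t; rewrite in_itv /= => /andP[t0 t1]; apply: dh; apply/andP; split; lra.
- apply: continuous_in_subspaceT => t; rewrite inE /= in_itv /= => ht.
  have := dh t ht => -[dt _].
  by apply: differentiable_continuous; exact/derivable1_diffP.
rewrite in_itv /= => /andP[c0 c1].
have bw : b + w = a by rewrite /w addrC subrK.
rewrite /h scale1r scale0r addr0 subr0 mulr1 bw => hc.
have -> : (F a - F b - 'd F x w) 0 j = F a 0 j - F b 0 j - 'd F x w 0 j by rewrite !mxE.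
have [|Uc Hc] := inU c; first by apply/andP; split; lra.
(* [Ck 1] gives continuity of derivatives in fixed directions only, so the derivative along [w] is
   expanded in the standard basis. *)
have E y : U y -> 'd F y w 0 j = \sum_k w 0 k * 'D_(delta_mx 0 k) F y 0 j.
  move=> Uy; rewrite {1}(row_sum_delta w) linear_sum summxE.
  by apply: eq_bigr => k _; rewrite linearZ mxE deriveE//; exact: dF.
rewrite (congr2 (fun p q : R => p - q) (etrans hc (E _ Uc)) (E _ Ux)) -sumrB.
apply: le_trans (ler_norm_sum _ _ _) _.
apply: le_trans (_ : \sum_(k < n) `|w| * e' <= _).
  apply: ler_sum => k _; rewrite -mulrBr normrM; apply: ler_pM => //.
    exact: mx_entry_norm_le.
  rewrite distrC; apply: le_trans (ltW (Hc k)).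
  have := mx_entry_norm_le ('D_(delta_mx 0 k) F x - 'D_(delta_mx 0 k) F (b + c *: w)) 0 j.
  by rewrite !mxE.
rewrite sumr_const card_ord -mulr_natl [_ * e']mulrC mulrA; apply: ler_wpM2r => //.
by rewrite /e' mulrA ler_pdivrMr// mulrC ler_pM2l// ler_nat.
Qed.

(** Surjectivity part of the inverse function theorem, by minimising the residual [|F p - w|] on a
    closed ball. The Newton step [q] stays in the ball and at least halves the residual, so a
    minimal residual is 0. *)
Lemma strict_diff_open n (F : 'rV[R]_n -> 'rV[R]_n) x J (U : set 'rV[R]_n) :
  strict_diff F x J -> (forall v : 'rV_n, `|v| <= `|v *m J|) -> nbhs x U ->
  nbhs (F x) (F @` U).
Proof.
move=> FJ expJ /nbhs_ballP[u /= u0 uU].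
have uJ : J \in unitmx.
  rewrite -row_free_unit; apply: inj_row_free => v vJ.
  by apply/eqP; rewrite -normr_le0; have := expJ v; rewrite vJ normr0.
have invJ (v : 'rV[R]_n) : `|v *m invmx J| <= `|v| by have := expJ (v *m invmx J); rewrite mulmxKV.
have [|r r0 H] := FJ (2^-1); first by lra.
have [s s0 cF] := strict_diff_continuous FJ.
pose d := Num.min u (Num.min r s) / 2.
have d0 : 0 < d by rewrite divr_gt0// !lt_min u0 r0 s0.
have [du dr ds] : [/\ d < u, d < r & d < s].
  have h : d < Num.min u (Num.min r s) by rewrite /d in d0 *; lra.
  by move: h; rewrite !lt_min => /and3P[].
pose B := [set p | `|p - x| <= d].
have cB : compact B by exact: norm_ball_compact.
apply/nbhs_ballP; exists (d / 2) => /=; first by rewrite divr_gt0.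
move=> w; rewrite -ball_normE /= => xw.
have [||p] := @EVT_min_rV R n (fun p => `|F p - w|) B _ cB.
- by exists x; rewrite /B /= subrr normr0 ltW.
- apply: continuous_in_subspaceT => p; rewrite inE /B /= => Bp.
  by apply: continuous_dist; apply: cF; apply: le_lt_trans ds.
rewrite inE /B /= => Bp minp; exists p.
  by apply: uU; rewrite -ball_normE /= distrC; exact: le_lt_trans du.
apply/eqP; rewrite -subr_eq0 -normr_le0 leNgt; apply/negP => pos.
pose q := p - (F p - w) *m invmx J.
(* Half of the radius comes from the error term, with constant 1/2, and half from
   [|F x - w| < d / 2], the inverse of [J] having norm at most 1. *)
have Bq : `|q - x| <= d.
  have := H p x (le_lt_trans Bp dr); rewrite subrr normr0 => /(_ r0) h1.
  have -> : q - x = - ((F p - F x - (p - x) *m J) *m invmx J) -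
      (F x - w) *m invmx J.
    rewrite mulmxBl mulmxK// opprB /q.
    have -> : F p - w = (F p - F x) + (F x - w) by rewrite addrA subrK.
    rewrite mulmxDl; set A1 := (F p - F x) *m _; set A2 := (F x - w) *m _.
    by rewrite opprD !addrA [p - A1 - A2 - x]addrAC (addrAC p).
  apply: le_trans (ler_normB _ _) _; rewrite normrN.
  by have := invJ (F p - F x - (p - x) *m J); have := invJ (F x - w); lra.
have := minp q; rewrite inE => /(_ Bq).
have := H q p (le_lt_trans Bq dr) (le_lt_trans Bp dr).
have -> : q - p = - ((F p - w) *m invmx J) by rewrite /q addrAC subrr sub0r.
rewrite mulNmx mulmxKV// opprK normrN addrA subrK.
have := invJ (F p - w); lra.
Qed.

End strict_differentiability.

(** * Charts and Riemannian metrics *)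

Section chart_theory.
Variables (R : realType) (n : nat) (Y : topologicalType).
Implicit Types (c d : chart R n Y) (y : Y).

Lemma chart_nbhs_dom c y : dom c y -> nbhs y (dom c).
Proof. by move=> cy; apply: open_nbhs_nbhs; split => //; exact: dom_open. Qed.

Lemma coord_continuous_at c y : dom c y -> {for y, continuous (coord c)}.
Proof.
move=> cy; have := @coord_continuous _ _ _ c.
by rewrite continuous_open_subspace; [apply; rewrite inE|exact: dom_open].
Qed.

Lemma param_coord c y : dom c y -> param c (coord c y) = y.
Proof. by move=> cy; apply: coordK; rewrite inE. Qed.

Lemma param_continuous_at c y : dom c y -> {for coord c y, continuous (param c)}.
Proof.
move=> cy; have := @param_continuous _ _ _ c.
rewrite continuous_open_subspace; last exact: cod_open.
by apply; rewrite inE; exists y.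
Qed.

Lemma cod_param c x : (coord c @` dom c) x -> dom c (param c x) /\ coord c (param c x) = x.
Proof. by case=> y cy <-; rewrite param_coord. Qed.

Lemma param_nbhs c y (W : set Y) : dom c y -> nbhs y W ->
  exists2 r, 0 < r & forall x, `|x - coord c y| < r ->
    [/\ dom c (param c x), coord c (param c x) = x & W (param c x)].
Proof.
move=> cy yW.
have h1 : nbhs (coord c y) (param c @^-1` W).
  by apply: (param_continuous_at cy); rewrite /= param_coord.
have h2 : nbhs (coord c y) (coord c @` dom c).
  by apply: open_nbhs_nbhs; split; [exact: cod_open|exists y].
have [r r0 H] := (nbhs_norm_lt _ _).1 (filterI h1 h2).
by exists r => // x /H[Wx /cod_param[? ?]]; split.
Qed.

Lemma coord_nbhs c y r : dom c y -> 0 < r ->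
  nbhs y [set z | dom c z /\ `|coord c z - coord c y| < r].
Proof.
move=> cy r0; apply: filterI; first exact: chart_nbhs_dom.
have yB : nbhs (coord c y) [set x | `|x - coord c y| < r].
  by apply/nbhs_norm_lt; exists r.
exact: (coord_continuous_at cy yB).
Qed.

Lemma coord_image_open c (W : set Y) : open W -> open (coord c @` (dom c `&` W)).
Proof.
move=> oW; rewrite openE => _ [y [cy Wy] <-].
have [r r0 H] := param_nbhs cy (open_nbhs_nbhs (conj oW Wy)).
apply/nbhs_norm_lt; exists r => // x /H[h1 h2 h3].
by exists (param c x).
Qed.

Variable A : smooth_structure R n Y.

Lemma local_rep_strict_diff c d y (g : Y -> Y) : C1_map A g ->
  charts A c -> charts A d -> dom c y -> dom d (g y) ->
  exists J, strict_diff (local_rep c d g) (coord c y) J.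
Proof.
move=> [cg g1] Ac Ad cy dy; eexists.
apply: (C1_strict_diff _ _ (g1 c d Ac Ad)); last by exists y.
apply: coord_image_open; apply: open_comp; last exact: dom_open.
by move=> z _; exact: cg.
Qed.

Lemma transition_strict_diff c d y : charts A c -> charts A d -> dom c y -> dom d y ->
  exists J, strict_diff (transition c d) (coord c y) J.
Proof.
move=> Ac Ad cy dy; eexists.
apply: (C1_strict_diff _ _ (charts_compatible Ac Ad 1%N)); last by exists y.
by apply: coord_image_open; exact: dom_open.
Qed.

(** Chain rule through an auxiliary chart around [iter k g y]. The composite of representations
    agrees with the representation of the iterate only near the point, hence [strict_diff_near]. *)
Lemma iter_rep_strict_diff (g : Y -> Y) : C1_map A g -> forall k c d y,
  charts A c -> charts A d -> dom c y -> dom d (iter k g y) ->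
  exists J, strict_diff (local_rep c d (iter k g)) (coord c y) J.
Proof.
move=> g1; elim=> [|k IH] c d y Ac Ad cy dy.
  exact: (@transition_strict_diff c d y).
have [e Ae ey] := charts_cover A (iter k g y).
have [J1 h1] := IH c e y Ac Ae cy ey.
have [J2 h2] := local_rep_strict_diff g1 Ae Ad ey dy.
have fy : local_rep c e (iter k g) (coord c y) = coord e (iter k g y).
  by rewrite /local_rep /= param_coord.
rewrite -fy in h2; have h := strict_diff_comp h1 h2.
exists (J1 *m J2); apply: strict_diff_near h.
have ck : continuous (iter k g).
  by apply: iter_continuous; case: g1.
have [r r0 H] := param_nbhs cy (ck y _ (chart_nbhs_dom ey)).
apply/nbhs_norm_lt; exists r => // x /H[_ _ h3].
by rewrite /local_rep /= param_coord.
Qed.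

End chart_theory.

(** * Comparison of the Riemannian norm with the coordinate norm *)

Section gram.
Variable R : realType.

Lemma bilin_norm_le n (G : 'M[R]_n) v w :
  `|bilin G v w| <= (n%:R ^+ 2 * `|G|) * `|v| * `|w|.
Proof.
rewrite /bilin; apply: le_trans (mx_entry_norm_le _ _ _) _.
apply: le_trans (mulmx_norm_le _ _) _.
have wT : `|w^T| <= `|w|.
  by apply: mx_norm_le => // i j; rewrite mxE; exact: mx_entry_norm_le.
have := mulmx_norm_le v G => h.
apply: le_trans (_ : n%:R * `|w| * (n%:R * `|G| * `|v|) <= _); last first.
  by rewrite le_eqVlt; apply/orP; left; apply/eqP; ring.
by apply: ler_pM => //; rewrite ?mulr_ge0// ler_wpM2l.
Qed.

Lemma bilinDl n (G : 'M[R]_n) u v w : bilin G (u + v) w = bilin G u w + bilin G v w.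
Proof. by rewrite /bilin !mulmxDl mxE. Qed.

Lemma bilinDr n (G : 'M[R]_n) u v w : bilin G u (v + w) = bilin G u v + bilin G u w.
Proof. by rewrite /bilin linearD mulmxDr mxE. Qed.

Lemma bilinDm n (G H : 'M[R]_n) u v : bilin (G + H) u v = bilin G u v + bilin H u v.
Proof. by rewrite /bilin mulmxDr mulmxDl mxE. Qed.

Lemma bilinZ n (G : 'M[R]_n) a v : bilin G (a *: v) (a *: v) = a ^+ 2 * bilin G v v.
Proof. by rewrite /bilin linearZ /= -!scalemxAl -scalemxAr !mxE mulrA. Qed.

(** A positive continuous function on the compact unit sphere has a positive lower bound;
    homogeneity does the rest. The argument covers an empty sphere ([n = 0]) as well. *)
Lemma bilin_lower n (G : 'M[R]_n) : (forall v, v != 0 -> 0 < bilin G v v) ->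
  exists2 a, 0 < a & forall v, a * `|v| ^+ 2 <= bilin G v v.
Proof.
move=> pos; pose S := [set v : 'rV[R]_n | `|v| = 1].
have cS : compact S.
  apply: bounded_closed_compact.
    exists 1; split; first exact: num_real.
    by move=> M xM p; rewrite /S /= => ->; exact: ltW.
  have -> : S = (fun p => `|p - 0|) @^-1` [set 1 : R].
    by apply/seteqP; split => p; rewrite /S /= subr0.
  apply: preimage_closed; last exact: closed_eq.
  by move=> p _; apply: (@continuous_dist _ _ _ id); exact: cvg_id.
have [|a a0 aS] := @compact_uniform_radius R _ S (fun e v => e <= bilin G v v) cS.
  move=> v Sv; have v0 : v != 0 by rewrite -normr_gt0 Sv ltr01.
  have B0 := pos v v0; set N := n%:R ^+ 2 * `|G|.
  have N0 : 0 <= N by rewrite mulr_ge0.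
  (* [3 * N] collects the two error terms, with [|u| <= 2] and [|v| = 1]. *)
  set r := Num.min 1 (bilin G v v / 2 / (3 * N + 1)).
  have N1 : 0 < 3 * N + 1 by lra.
  have r0 : 0 < r by rewrite lt_min ltr01 !divr_gt0.
  have r1 : r <= 1 by rewrite ge_min lexx.
  exists (ball v r), (bilin G v v / 2); split; [exact: nbhsx_ballx|lra|].
  move=> u e; rewrite -ball_normE /= distrC => uv /andP[e0 eB].
  have un : `|u| <= 2.
    by have := ler_normD (u - v) v; rewrite subrK Sv; lra.
  have -> : bilin G u u = bilin G v v + (bilin G (u - v) u + bilin G v (u - v)).
    have -> : bilin G (u - v) u = bilin G u u - bilin G v u.
      by apply/eqP; rewrite eq_sym subr_eq -bilinDl subrK.
    have -> : bilin G v (u - v) = bilin G v u - bilin G v v.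
      by apply/eqP; rewrite eq_sym subr_eq -bilinDr subrK.
    by ring.
  have h1 := bilin_norm_le G (u - v) u; have h2 := bilin_norm_le G v (u - v).
  rewrite -/N in h1 h2; rewrite Sv mulr1 in h2.
  have h3 : N * `|u - v| * `|u| <= N * `|u - v| * 2 by rewrite ler_wpM2l// mulr_ge0.
  have h4 : 3 * N * `|u - v| <= bilin G v v / 2.
    apply: le_trans (_ : (3 * N + 1) * `|u - v| <= _).
      by rewrite ler_wpM2r// lerDl.
    rewrite mulrC -ler_pdivlMr//; apply: ltW; apply: lt_le_trans uv _.
    by rewrite /r ge_min lexx orbT.
  move: h1 h2; rewrite !ler_norml => /andP[h1 _] /andP[h2 _]; lra.
exists a => // v; have [->|v0] := eqVneq v 0.
  by rewrite normr0 expr0n mulr0 /bilin mul0mx mul0mx mxE.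
have nv : 0 < `|v| by rewrite normr_gt0.
have Sv : S (`|v|^-1 *: v).
  by rewrite /S /= normrZ gtr0_norm ?invr_gt0// mulVf ?gt_eqF.
have -> : bilin G v v = `|v| ^+ 2 * bilin G (`|v|^-1 *: v) (`|v|^-1 *: v).
  by rewrite -bilinZ scalerA divff ?gt_eqF// scale1r.
by rewrite mulrC ler_pM2l ?exprn_gt0//; exact: aS.
Qed.

Variables (n : nat) (Y : topologicalType) (A : smooth_structure R n Y).
Variable rho : riemannian_metric A.

(** The lower bound [a] at [y] survives as [a / 2] where the Gram matrix has moved by an amount
    whose form is bounded by [a / 2]. *)
Lemma gram_bounds c y : charts A c -> dom c y ->
  exists M W, [/\ 0 < M, nbhs y W & forall z v, W z ->
    `|v| ^+ 2 <= M * bilin (gram rho c (coord c z)) v v /\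
    bilin (gram rho c (coord c z)) v v <= M * `|v| ^+ 2].
Proof.
move=> Ac cy; set G := gram rho c.
have [|a a0 low] := @bilin_lower n (G (coord c y)).
  by move=> v; apply: gram_posdef => //; exists y.
have cG : {for coord c y, continuous G}.
  by have := gram_smooth rho Ac 0%N; apply; exists y.
set N := n%:R ^+ 2 : R; have N0 : 0 <= N by rewrite exprn_ge0.
have e0 : 0 < a / 2 / (N + 1) by rewrite !divr_gt0// ltr_wpDl.
have cGc : {for y, continuous (G \o coord c)}.
  by apply: continuous_comp; [exact: coord_continuous_at|exact: cG].
set C := N * `|G (coord c y)| + a / 2; have C0 : 0 < C by rewrite ltr_wpDl ?mulr_ge0//; lra.
exists (Num.max (a / 2)^-1 C), [set z | `|G (coord c y) - G (coord c z)| < a / 2 / (N + 1)].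
split.
- by rewrite lt_max C0 orbT.
- by have /cvgrPdist_lt/(_ _ e0) := cGc.
move=> z v /= Wz.
have -> : G (coord c z) = G (coord c y) + (G (coord c z) - G (coord c y)).
  by rewrite addrC subrK.
rewrite bilinDm; set E := G (coord c z) - _.
have hE : N * `|E| <= a / 2.
  apply: le_trans (_ : (N + 1) * `|E| <= _); first by rewrite ler_wpM2r// lerDl.
  by rewrite mulrC -ler_pdivlMr ?ltr_wpDl// /E distrC ltW.
have h1 := low v.
have h2 : `|bilin E v v| <= a / 2 * `|v| ^+ 2.
  by apply: le_trans (bilin_norm_le _ _ _) _; rewrite -mulrA ler_wpM2r// mulr_ge0.
have h3 : bilin (G (coord c y)) v v <= N * `|G (coord c y)| * `|v| ^+ 2.
  by apply: le_trans (ler_norm _) _; apply: le_trans (bilin_norm_le _ _ _) _; rewrite -mulrA.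
move: h2; rewrite ler_norml => /andP[h2 h2'].
have v2 : 0 <= `|v| ^+ 2 by rewrite exprn_ge0.
split.
  apply: le_trans (_ : (a / 2)^-1 * (bilin (G (coord c y)) v v + bilin E v v) <= _).
    by rewrite mulrC ler_pdivlMr; lra.
  rewrite ler_wpM2r ?le_max ?lexx//; have : 0 <= a / 2 * `|v| ^+ 2 by rewrite mulr_ge0//; lra.
  by lra.
apply: le_trans (_ : C * `|v| ^+ 2 <= _); first by rewrite /C mulrDl; lra.
by rewrite ler_wpM2r ?le_max ?lexx ?orbT.
Qed.

End gram.

(** * Bi-Lipschitz embedding *)

(* Unlike [compact_cover], for spaces without a distinguished point. *)
Lemma compact_finite_subcover (X : topologicalType) (K : set X) (W : X -> set X) :
  compact K -> (forall x, K x -> nbhs x (W x)) ->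
  exists s : seq X, forall x, K x -> exists2 i, i \in s & W i x.
Proof.
move=> /compact_near_coveringP cK xW.
(* Filter of the properties that hold for all sufficiently large finite sets of centres. *)
pose F := [set S : set (seq X) | exists s : seq X, forall t : seq X, {subset s <= t} -> S t].
have FF : Filter F.
  split; first by exists [::].
  - move=> P Q [s sP] [t tQ]; exists (s ++ t) => u stu; split.
      by apply: sP => x xs; apply: stu; rewrite mem_cat xs.
    by apply: tQ => x xt; apply: stu; rewrite mem_cat xt orbT.
  - by move=> P Q PQ [s sP]; exists s => t /sP /PQ.
have := @cK _ F (fun t x => exists2 i, i \in t & W i x) FF.
case=> [x Kx|s /(_ s)]; last by move=> H; exists s => x Kx; apply: H.
exists (W x, [set t : seq X | x \in t]).
  split => /=; first exact: xW.
  by exists [:: x] => t; apply; rewrite inE.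
by case=> x' t /= [Wx' xt]; exists x.
Qed.

Section embedding.
Variables (R : realType) (n : nat) (Y : topologicalType).
Variable A : smooth_structure R n Y.
Hypothesis cY : compact [set: Y].
Hypothesis hY : hausdorff_space Y.
Implicit Types (c d : chart R n Y) (y : Y).

(** Required in every chart of the atlas, so that it can be used in whichever chart provides the
    reverse inequality. *)
Definition locally_lipschitz (V : normedModType R) (phi : Y -> V) :=
  forall d y, charts A d -> dom d y -> exists K W, [/\ 0 <= K, nbhs y W &
    forall u v, W u -> W v -> dom d u -> dom d v ->
      `|phi u - phi v| <= K * `|coord d u - coord d v|].

Section bump.
Variables (c : chart R n Y) (x0 : 'rV[R]_n) (r : R).

Definition bump_profile (x : 'rV[R]_n) : R := clamp01 (2 - `|x - x0| / r).

(** Besides the cut-off coordinates, the cut-off function itself is recorded: it separates the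
    plateau, where it is 1, from the points outside the chart. *)
Definition bump y : R^o * 'rV[R]_n :=
  if `[< dom c y >] then (bump_profile (coord c y), bump_profile (coord c y) *: coord c y)
  else (0, 0).

Hypothesis Ac : charts A c.
Hypothesis r0 : 0 < r.
Hypothesis Hr : forall x, `|x - x0| <= 2 * r -> (coord c @` dom c) x.

Lemma bump_plateau y : dom c y -> `|coord c y - x0| < r ->
  bump y = (1, coord c y).
Proof.
move=> cy yr; rewrite /bump asboolT//.
suff -> : bump_profile (coord c y) = 1 by rewrite scale1r.
have : `|coord c y - x0| / r <= 1 by rewrite ler_pdivrMr// mul1r ltW.
move=> h; rewrite /bump_profile /clamp01 min_r; last lra.
by rewrite max_r.
Qed.

Lemma bump_outside y : (dom c y -> 2 * r <= `|coord c y - x0|) -> bump y = 0.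
Proof.
rewrite /bump; case: asboolP => // cy /(_ cy) yr.
suff -> : bump_profile (coord c y) = 0 by rewrite scale0r.
have : 2 <= `|coord c y - x0| / r by rewrite ler_pdivlMr.
by move=> h; rewrite /bump_profile /clamp01 min_l ?max_l//; lra.
Qed.

Lemma bump_profile_dist x z : `|bump_profile x - bump_profile z| <= r^-1 * `|x - z|.
Proof.
apply: le_trans (clamp01_dist _ _) _.
have -> : 2 - `|x - x0| / r - (2 - `|z - x0| / r) = r^-1 * (`|z - x0| - `|x - x0|) by ring.
rewrite normrM gtr0_norm ?invr_gt0//; apply: ler_wpM2l; first by rewrite invr_ge0 ltW.
apply: le_trans (ler_dist_dist _ _) _.
by rewrite opprB addrA subrK distrC.
Qed.

Lemma bump_profile_norm x : `|bump_profile x| <= 1.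
Proof.
have /andP[h1 h2] := clamp01_I01 (2 - `|x - x0| / r).
by rewrite ger0_norm.
Qed.

(** Inside the chart the bump is Lipschitz in the coordinates of [c], and the transition map is
    locally Lipschitz. Outside, it vanishes near [y]: its support lies in the image of a compact
    ball, which is closed because [Y] is Hausdorff. *)
Lemma bump_locally_lipschitz : locally_lipschitz bump.
Proof.
move=> d y Ad dy; have [cy|ncy] := pselect (dom c y).
  have [J /strict_diff_lipschitz[K [s [K0 s0 lip]]]] := transition_strict_diff Ad Ac dy cy.
  set B := `|coord c y| + 1; have B0 : 0 <= B by rewrite addr_ge0.
  exists ((1 + r^-1 * (1 + B)) * K), ([set z | dom d z /\ `|coord d z - coord d y| < s] `&`
    [set z | dom c z /\ `|coord c z - coord c y| < 1]).
  have ri0 : 0 <= r^-1 by rewrite invr_ge0 ltW.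
  have C0 : 0 <= 1 + r^-1 * (1 + B) by rewrite addr_ge0// mulr_ge0// addr_ge0.
  split; first by rewrite mulr_ge0// ltW.
    by apply: filterI; exact: coord_nbhs.
  move=> u v [[_ us] [cu ub]] [[_ vs] [cv vb]] du dv.
  have := lip _ _ us vs; rewrite /transition /= !param_coord// => h.
  rewrite -mulrA; apply: le_trans (ler_wpM2l C0 h).
  rewrite /bump !asboolT// prod_normE /=.
  set a := coord c u; set b := coord c v.
  have hb := bump_profile_dist a b.
  have bB : `|b| <= B.
    by have := ler_normD (b - coord c y) (coord c y); rewrite subrK /B /b; lra.
  have ab0 : 0 <= `|a - b| by [].
  have rab : 0 <= r^-1 * `|a - b| by rewrite mulr_ge0.
  have Brab : 0 <= r^-1 * B * `|a - b| by rewrite !mulr_ge0.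
  have e : (1 + r^-1 * (1 + B)) * `|a - b| = `|a - b| + r^-1 * `|a - b| + r^-1 * B * `|a - b|.
    by ring.
  rewrite ge_max e; apply/andP; split; first by apply: le_trans hb _; lra.
  have -> : bump_profile a *: a - bump_profile b *: b =
      bump_profile a *: (a - b) + (bump_profile a - bump_profile b) *: b.
    by rewrite scalerBr scalerBl addrA subrK.
  apply: le_trans (ler_normD _ _) _; rewrite !normrZ.
  have h1 : `|bump_profile a| * `|a - b| <= `|a - b|.
    by rewrite ler_piMl// bump_profile_norm.
  have h2 : `|bump_profile a - bump_profile b| * `|b| <= r^-1 * `|a - b| * B.
    by apply: ler_pM.
  have : r^-1 * `|a - b| * B = r^-1 * B * `|a - b| by ring.
  by lra.
pose K := param c @` [set x | `|x - x0| <= 2 * r].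
have clK : closed K.
  apply: compact_closed => //; apply: continuous_compact.
    apply: continuous_in_subspaceT => x; rewrite inE => /Hr[z cz <-].
    exact: param_continuous_at.
  exact: norm_ball_compact.
exists 0, (~` K); split => //.
  apply: open_nbhs_nbhs; split; first exact: closed_openC.
  by case=> x /Hr[z cz <-]; rewrite param_coord// => zy; apply: ncy; rewrite -zy.
move=> u v Ku Kv _ _.
have E z : (~` K) z -> bump z = 0.
  move=> Kz; apply: bump_outside => cz; rewrite leNgt; apply/negP => h.
  by apply: Kz; exists (coord c z); [exact: ltW|rewrite param_coord].
by rewrite !E// subrr normr0 mul0r.
Qed.

End bump.

(** The target is an iterated product, so the space itself is built by induction; the maximum norm
    dominates each factor. *)
Lemma locally_lipschitz_seq (I : eqType) (V0 : normedModType R) (phi : I -> Y -> V0)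
    (s : seq I) : (forall i, locally_lipschitz (phi i)) ->
  exists (V : normedModType R) (Phi : Y -> V), locally_lipschitz Phi /\
    forall i, i \in s -> forall u v, `|phi i u - phi i v| <= `|Phi u - Phi v|.
Proof.
move=> lphi; elim: s => [|i s [V [Phi [lPhi HPhi]]]].
  exists V0, (fun=> 0); split => // d y Ad dy.
  exists 0, setT; split => //; first exact: filterT.
  by move=> u v _ _ _ _; rewrite subrr normr0 mul0r.
exists (V0 * V)%type, (fun y => (phi i y, Phi y)); split.
  move=> d y Ad dy; have [K1 [W1 [K10 yW1 H1]]] := lphi i d y Ad dy.
  have [K2 [W2 [K20 yW2 H2]]] := lPhi d y Ad dy.
  exists (K1 + K2), (W1 `&` W2); split; [exact: addr_ge0|exact: filterI|].
  move=> u v [u1 u2] [v1 v2] du dv; rewrite prod_normE /= ge_max.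
  have := H1 u v u1 v1 du dv; have := H2 u v u2 v2 du dv.
  have : 0 <= K1 * `|coord d u - coord d v| by rewrite mulr_ge0.
  have : 0 <= K2 * `|coord d u - coord d v| by rewrite mulr_ge0.
  by rewrite mulrDl => *; apply/andP; split; lra.
move=> j; rewrite in_cons => js u v; rewrite prod_normE /= le_max.
by case/predU1P: js => [->|js]; rewrite ?lexx// HPhi// orbT.
Qed.

(* [Phi] collects the coordinates cut off by finitely many bump functions. *)
Lemma bilipschitz_embedding : exists (V : normedModType R) (Phi : Y -> V),
  [/\ locally_lipschitz Phi, injective Phi &
    forall y, exists c W, [/\ charts A c, dom c y, nbhs y W &
      forall u v, W u -> W v -> `|coord c u - coord c v| <= `|Phi u - Phi v|]].
Proof.
have /choice[cr crP] : forall y, exists cr : chart R n Y * R,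
    [/\ charts A cr.1, dom cr.1 y, 0 < cr.2 &
      forall x, `|x - coord cr.1 y| <= 2 * cr.2 -> (coord cr.1 @` dom cr.1) x].
  move=> y; have [c Ac cy] := charts_cover A y.
  have [r r0 H] := param_nbhs cy (chart_nbhs_dom cy).
  (* With [r / 3] the closed ball of twice the radius stays within the ball of radius [r]. *)
  exists (c, r / 3); split => //=; first by rewrite divr_gt0.
  move=> x xr; have [|h1 h2 _] := H x; first by lra.
  by exists (param c x).
pose W y := [set z | dom (cr y).1 z /\ `|coord (cr y).1 z - coord (cr y).1 y| < (cr y).2].
have oW y : open (W y).
  rewrite openE => z [cz zr].
  have s0 : 0 < (cr y).2 - `|coord (cr y).1 z - coord (cr y).1 y| by rewrite subr_gt0.
  apply: filterS (coord_nbhs cz s0) => u [cu us]; split => //.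
  by have := ler_distD (coord (cr y).1 z) (coord (cr y).1 u) (coord (cr y).1 y); lra.
have Wy y : W y y.
  by have [_ cy r0 _] := crP y; split => //; rewrite subrr normr0.
have [s cover] : exists s : seq Y, forall y, [set: Y] y -> exists2 i, i \in s & W i y.
  by apply: compact_finite_subcover => // y _; apply: open_nbhs_nbhs; split.
pose phi y := bump (cr y).1 (coord (cr y).1 y) (cr y).2.
have lphi y : locally_lipschitz (phi y).
  by have [Ac cy r0 H] := crP y; exact: bump_locally_lipschitz.
have [V [Phi [lPhi HPhi]]] := @locally_lipschitz_seq Y _ phi s lphi.
exists V, Phi; split => //.
(* On the plateau containing [u] the first component is 1, which forces [v] into the chart with
   cut-off 1; the second component then gives equal coordinates. *)
- move=> u v uv; have [i si Wu] := cover u I.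
  have := HPhi i si u v; rewrite uv subrr normr0 normr_le0 subr_eq0 => /eqP e.
  have [Ac ci r0 H] := crP i; have [cu ur] := Wu.
  move: e; rewrite /phi bump_plateau// /bump; case: asboolP => cv; last first.
    by case=> /eqP; rewrite oner_eq0.
  by case=> <-; rewrite scale1r => e; rewrite -(param_coord cu) e param_coord.
- move=> y; have [i si Wiy] := cover y I; have [Ac ci r0 H] := crP i.
  exists (cr i).1, (W i); split => //; first by case: Wiy.
    by apply: open_nbhs_nbhs; split.
  move=> u v [cu ur] [cv vr]; apply: le_trans (HPhi i si u v).
  by rewrite /phi !bump_plateau// prod_normE /= le_max lexx orbT.
Qed.

End embedding.

(** * Expanding endomorphisms *)

Lemma continuous_segment (R : realType) (T : topologicalType) (V : normedModType R)
    (a : T -> R) (F : T -> V) (w : V) (x : T) :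
  {for x, continuous a} -> {for x, continuous F} ->
  {for x, continuous (fun z => (1 - a z) *: F z + a z *: w)}.
Proof.
move=> ca cF; apply: cvgD; apply: cvgZ => //; last exact: cvg_cst.
by apply: cvgB => //; exact: cvg_cst.
Qed.

Section expanding.
Variables (R : realType) (n : nat) (Y : topologicalType).
Variable A : smooth_structure R n Y.
Variable rho : riemannian_metric A.

(** A single [M] controls both comparisons: coordinates with [Phi] near [y], and the Euclidean-type
    norm with the Riemannian one at [y]. *)
Definition good_chart (V : normedModType R) (Phi : Y -> V) (M : R) (c : chart R n Y) (y : Y) :=
  [/\ charts A c, dom c y,
      exists2 W, nbhs y W & forall u v, W u -> W v -> [/\ dom c u,
        `|coord c u - coord c v| <= `|Phi u - Phi v| &
        `|Phi u - Phi v| <= M * `|coord c u - coord c v|] &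
      forall w, `|w| ^+ 2 <= M * bilin (gram rho c (coord c y)) w w /\
        bilin (gram rho c (coord c y)) w w <= M * `|w| ^+ 2].

Lemma good_chart_uniform (V : normedModType R) (Phi : Y -> V) :
  compact [set: Y] -> locally_lipschitz A Phi ->
  (forall y, exists c W, [/\ charts A c, dom c y, nbhs y W &
      forall u v, W u -> W v -> `|coord c u - coord c v| <= `|Phi u - Phi v|]) ->
  exists2 M, 0 < M & forall y, exists c, good_chart Phi M c y.
Proof.
move=> cY lPhi ePhi.
(* [M] is taken as an inverse, so that large constants correspond to small radii. *)
have [|e e0 H] := @compact_uniform_radius R Y setT
    (fun e y => exists c, good_chart Phi e^-1 c y) cY; last first.
  by exists e^-1 => [|y]; [rewrite invr_gt0|exact: H].
move=> y _; have [c [W1 [Ac cy yW1 H1]]] := ePhi y.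
have [K [W2 [K0 yW2 H2]]] := lPhi c y Ac cy.
have [M [W3 [M0 yW3 H3]]] := gram_bounds rho Ac cy.
pose W := (W1 `&` W2) `&` (W3 `&` dom c).
have yW : nbhs y W.
  by apply: filterI; apply: filterI => //; exact: chart_nbhs_dom.
(* [W] is a neighbourhood of each point of its interior, so the same chart is good there. *)
exists W°, (K + M)^-1; split; first exact: nbhs_interior.
  by rewrite invr_gt0 ltr_wpDl.
move=> u e uW /andP[e0 eKM]; exists c.
have [_ [W3u cu]] := interior_subset uW.
have KMe : K + M <= e^-1 by rewrite -[K + M]invrK lef_pV2// posrE invr_gt0 ltr_wpDl.
have [Ke Me] : K <= e^-1 /\ M <= e^-1 by split; lra.
split => //.
  exists W; first exact: uW.
  move=> v1 v2 [[a1 a2] [a3 a4]] [[b1 b2] [b3 b4]]; split => //; first exact: H1.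
  by apply: le_trans (H2 v1 v2 a2 b2 a4 b4) _; rewrite ler_wpM2r.
move=> w; have [h1 h2] := H3 u w W3u.
have b0 : 0 <= bilin (gram rho c (coord c u)) w w.
  by rewrite -(pmulr_rge0 _ M0); apply: le_trans h1; rewrite exprn_ge0.
by split; [apply: le_trans h1 _|apply: le_trans h2 _]; rewrite ler_wpM2r// exprn_ge0.
Qed.

(** Coordinate balls are convex: the straight-line homotopy to [p 0] stays in the range of the
    chart. *)
Lemma chart_loops_null_homotopic (y : Y) : exists2 U : set Y, nbhs y U &
  @loops_null_homotopic R Y U.
Proof.
have [c Ac cy] := charts_cover A y.
have [r r0 H] := param_nbhs cy (chart_nbhs_dom cy).
exists [set z | dom c z /\ `|coord c z - coord c y| < r]; first exact: coord_nbhs.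
move=> p cp pU p10.
pose h (x : R * R) := (1 - x.1) *: coord c (p x.2) + x.1 *: coord c (p 0).
have I0 : I01 (0 : R) by rewrite /I01 /= lexx ler01.
have I1 : I01 (1 : R) by rewrite /I01 /= lexx ler01.
have hr (x : R * R) : (@I01 R `*` @I01 R) x -> `|h x - coord c y| < r.
  case: x => s t [/= /andP[s0 s1] It].
  have -> : h (s, t) - coord c y = (1 - s) *: (coord c (p t) - coord c y) +
      s *: (coord c (p 0) - coord c y).
    by rewrite /h /=; apply/rowP => j; rewrite !mxE; ring.
  have [_ h1] := pU t It; have [_ h2] := pU 0 I0.
  have s1' : 0 <= 1 - s by lra.
  apply: le_lt_trans (ler_normD _ _) _; rewrite !normrZ !ger0_norm//.
  have [s00|sn0] := eqVneq s 0; first by rewrite s00; lra.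
  have sp : 0 < s by rewrite lt_neqAle eq_sym sn0.
  have k1 : s * `|coord c (p 0) - coord c y| < s * r by rewrite ltr_pM2l.
  have k2 : (1 - s) * `|coord c (p t) - coord c y| <= (1 - s) * r.
    by rewrite ler_wpM2l// ltW.
  by apply: lt_le_trans (ler_ltD k2 k1) _; rewrite -mulrDl subrK mul1r.
exists (param c \o h); split => /=.
- apply: (@within_comp _ _ _ _ [set x | `|x - coord c y| < r]).
  + apply: continuous_in_subspaceT => x; rewrite inE => /H[h1 h2 _].
    by rewrite -h2; exact: param_continuous_at.
  + apply: continuous_in_subspaceT => -[s t]; rewrite inE => -[_ /= It].
    apply: continuous_segment; first exact: cvg_fst.
    apply: (@continuous_comp (R * R)%type Y _ (p \o snd) (coord c)).
      by apply: continuous_comp; [exact: cvg_snd|exact: cp].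
    by apply: coord_continuous_at; case: (pU t It).
  + exact: hr.
- move=> t It; rewrite /h /= subr0 scale1r scale0r addr0 param_coord//.
  by case: (pU t It).
- move=> t It; rewrite /h /= subrr scale0r scale1r add0r param_coord//.
  by case: (pU 0 I0).
- move=> s Is; rewrite /h /= p10 -scalerDl subrK scale1r param_coord//.
  by case: (pU 0 I0).
Qed.

(** In good charts the Jacobian expands the coordinate norm by [2 * M + 1]. The strict
    differentiability error, taken with constant 1, leaves [2 * M], and [|Phi u - Phi v| <= M *
    |coord c u - coord c v|] leaves 2. *)
Lemma iter_locally_expanding (V : normedModType R) (Phi : Y -> V) (M C lambda : R)
    (g : Y -> Y) k y : C1_map A g -> 0 < M -> 0 < C -> 1 < lambda ->
  (forall y, exists c, good_chart Phi M c y) ->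
  (forall c d y v, charts A c -> charts A d -> dom c y -> dom d (iter k g y) ->
     C * lambda ^+ k * rnorm rho c y v <=
     rnorm rho d (iter k g y) ('d (local_rep c d (iter k g)) (coord c y) v)) ->
  M * (2 * M + 1) <= C * lambda ^+ k ->
  (forall U, nbhs y U -> nbhs (iter k g y) (iter k g @` U)) /\
  exists2 U, nbhs y U & forall u v, U u -> U v ->
    2 * `|Phi u - Phi v| <= `|Phi (iter k g u) - Phi (iter k g v)|.
Proof.
move=> g1 M0 C0 l1 good expand large; set f := iter k g.
have cf : continuous f by apply: iter_continuous; case: g1.
have [c [Ac cy [W yW HW] qc]] := good y.
have [d [Ad dfy [W' yW' HW'] qd]] := good (f y).
have [J FJ] := iter_rep_strict_diff g1 Ac Ad cy dfy.
have fy : local_rep c d f (coord c y) = coord d (f y) by rewrite /local_rep /= param_coord.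
have Cl0 : 0 < C * lambda ^+ k by rewrite mulr_gt0// exprn_gt0//; lra.
have expJ (v : 'rV[R]_n) : (2 * M + 1) * `|v| <= `|v *m J|.
  have := expand c d y v Ac Ad cy dfy; rewrite (strict_diff_diff v FJ) /rnorm => h.
  set b1 := bilin _ v v in h; set b2 := bilin _ (v *m J) _ in h.
  have [h1 _] := qc v; have [_ h2] := qd (v *m J).
  rewrite -/b1 in h1; rewrite -/b2 in h2.
  have b10 : 0 <= b1 by rewrite -(pmulr_rge0 _ M0); apply: le_trans h1; rewrite exprn_ge0.
  have b20 : 0 <= b2.
    have [h3 _] := qd (v *m J).
    by rewrite -(pmulr_rge0 _ M0); apply: le_trans h3; rewrite exprn_ge0.
  have h' : (C * lambda ^+ k) ^+ 2 * b1 <= b2.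
    rewrite -[X in _ * X](sqr_sqrtr b10) -[leRHS](sqr_sqrtr b20) -exprMn.
    rewrite ler_pXn2r ?nnegrE ?sqrtr_ge0//.
    exact: mulr_ge0 (ltW Cl0) (sqrtr_ge0 _).
  have M21 : 0 <= 2 * M + 1 by lra.
  rewrite -(@ler_pXn2r _ 2)// ?nnegrE ?mulr_ge0//.
  (* One factor [M] is spent comparing the metric with coordinates at [y], the other at [f y]. *)
  rewrite -(@ler_pM2l _ (M * M)) ?mulr_gt0//.
  apply: le_trans (_ : M * ((C * lambda ^+ k) ^+ 2 * b1) <= _).
    apply: le_trans (_ : (C * lambda ^+ k) ^+ 2 * `|v| ^+ 2 <= _).
      have -> : M * M * ((2 * M + 1) * `|v|) ^+ 2 = (M * (2 * M + 1)) ^+ 2 * `|v| ^+ 2 by ring.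
      apply: ler_wpM2r; first exact: exprn_ge0.
      rewrite ler_pXn2r ?nnegrE//; last exact: ltW.
      exact: mulr_ge0 (ltW M0) M21.
    by rewrite [leRHS]mulrCA ler_wpM2l// exprn_ge0// ltW.
  apply: le_trans (_ : M * b2 <= _); first by rewrite ler_wpM2l// ltW.
  by rewrite -mulrA ler_wpM2l// ltW.
split.
  move=> U yU.
  have [r r0 H] := param_nbhs cy (filterI yU (cf y _ (chart_nbhs_dom dfy))).
  have xV : nbhs (coord c y) [set x | `|x - coord c y| < r] by apply/nbhs_norm_lt; exists r.
  have := strict_diff_open FJ _ xV; rewrite fy => op.
  have {}op : nbhs (coord d (f y)) (local_rep c d f @` [set x | `|x - coord c y| < r]).
    apply: op => v; apply: le_trans (expJ v).
    have : 0 <= M * `|v| by rewrite mulr_ge0// ltW.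
    by rewrite mulrDl mul1r -mulrA; lra.
  have op' : nbhs (f y) (coord d @^-1` (local_rep c d f @` [set x | `|x - coord c y| < r])).
    exact: coord_continuous_at dfy _ op.
  apply: filterS (filterI (chart_nbhs_dom dfy) op') => z /= [dz [x /H[cx xe [Ux dfx]] e]].
  exists (param c x) => //; rewrite -(param_coord dz) -e /local_rep /=.
  by rewrite param_coord.
have [r r0 H] := FJ 1 ltr01.
exists ((W `&` [set z | dom c z /\ `|coord c z - coord c y| < r]) `&` f @^-1` W').
  by apply: filterI; [apply: filterI => //; exact: coord_nbhs|exact: cf].
move=> u v [[Wu [cu ur]] fu] [[Wv [cv vr]] fv].
have [_ _ h1] := HW u v Wu Wv; have [_ h2 _] := HW' (f u) (f v) fu fv.
have := H _ _ ur vr; rewrite /local_rep /= !param_coord// mul1r => h3.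
have h4 := expJ (coord c u - coord c v).
have h5 := ler_normD (coord d (f u) - coord d (f v) - (coord c u - coord c v) *m J)
  (- (coord d (f u) - coord d (f v))).
apply: le_trans h2; apply: le_trans (ler_wpM2l _ h1) _ => //.
move: h5; rewrite addrAC subrr sub0r !normrN.
by rewrite mulrDl mul1r -mulrA in h4; lra.
Qed.

End expanding.

(** * Stabilizers of the odometer action and loops in iterated images *)

Section odometer_stabilizer.
Variables (G : groupType) (phi : G -> G).
Hypothesis phiM : forall a b : G, phi (a * b)%g = (phi a * phi b)%g.

(** The stabilizer of a coset [c H] is the conjugate of [H] by [c]; here [c] represents the [i]-th
    entry of the thread and depends on [i]. *)
Lemma odometer_fixed_conjugate (a : G) (w : odometer phi) : odometer_act a w = w ->
  forall i, exists c b : G, (a * c = c * iter i phi b)%g.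
Proof.
move=> aw i; have [c wc] := thread_level w i.
have iM b b' : iter i phi (b * b')%g = (iter i phi b * iter i phi b')%g.
  by elim: i {wc} => //= j ->.
have i1 : iter i phi 1%g = 1%g.
  by apply: (mulgI (iter i phi 1%g)); rewrite -iM !mulg1.
have : lcoset_of a (w i) = w i by rewrite -[in RHS]aw.
rewrite wc lcoset_of_mul => /seteqP[sub _].
have [|_ [b _ <-] e] := sub (a * c)%g.
  by exists 1%g; [exists 1%g; rewrite ?i1|rewrite mulg1].
by exists c, b.
Qed.

End odometer_stabilizer.

(** Provides a representative equal pointwise to the image of [be], as the lifting argument needs
    more than a homotopy class. *)
Lemma iter_pi1_map (R : realType) (Y : topologicalType) (y0 : Y) (g : Y -> Y)
    (cg : continuous g) (gy0 : g y0 = y0) m (be : loop R y0) :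
  exists ze : loop R y0, (forall t, ze t = iter m g (be t)) /\
    iter m (pi1_map cg gy0) (pi1_class be) = pi1_class ze.
Proof.
elim: m => [|m [ze [zeE e]]]; first by exists be.
exists (loop_map cg gy0 ze); split; first by move=> t /=; rewrite zeE.
by rewrite iterS e pi1_map_class.
Qed.

Theorem proposition2p1 (R : realType) (n : nat) (Y : topologicalType)
  (A : smooth_structure R n Y) (rho : riemannian_metric A)
  (Yflat : flat_manifold rho)
  (g : Y -> Y) (g_exp : expanding_endomorphism A g)
  (y0 : Y) (g_y0 : g y0 = y0) :
  free_action
    (odometer_act (phi := pi1_map (R := R) (expanding_continuous g_exp) g_y0)).
Proof.
move=> a w a1 aw; apply: a1; case: Yflat => _ [hY _] cY _ _.
have conj := odometer_fixed_conjugate (pi1_mapM _ _) aw.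
have cg := expanding_continuous g_exp.
have [g1 [rho' [C [lambda [C0 l1 expand]]]]] := g_exp.
have [V [Phi [lPhi iPhi ePhi]]] := bilipschitz_embedding A cY hY.
have cPhi : continuous Phi.
  move=> y; apply/cvgrPdist_lt => e e0.
  have [c Ac cy] := charts_cover A y.
  have [K [W [K0 yW HW]]] := lPhi c y Ac cy.
  have eK : 0 < e / (K + 1) by rewrite divr_gt0// ltr_wpDl.
  have Wy := nbhs_singleton yW.
  apply: filterS2 yW (coord_nbhs cy eK) => z Wz [cz zy].
  apply: le_lt_trans (HW y z Wy Wz cy cz) _.
  apply: le_lt_trans (_ : (K + 1) * `|coord c y - coord c z| < e).
    by rewrite ler_wpM2r// lerDl.
  by rewrite mulrC -ltr_pdivlMr ?ltr_wpDl// distrC.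
have [M M0 good] := good_chart_uniform rho' cY lPhi ePhi.
have [k k1 large] : exists2 k, (1 <= k)%N & M * (2 * M + 1) <= C * lambda ^+ k.
  have MM : 0 < M * (2 * M + 1) by rewrite mulr_gt0//; lra.
  have e0 : 0 < C / (M * (2 * M + 1)) by rewrite divr_gt0.
  have l0 : 0 < lambda by lra.
  (* The successor is taken because expansion is assumed only for exponents at least 1. *)
  have /cvgrPdist_lt/(_ _ e0)[N _ /(_ N.+1 (leqnSn N))] :
      (geometric 1 lambda^-1 : R ^nat) @ \oo --> (0 : R).
    by apply: cvg_geometric; rewrite gtr0_norm ?invr_gt0// invf_lt1.
  rewrite /= sub0r normrN mul1r exprVn ger0_norm ?invr_ge0 ?exprn_ge0 ?ltW// => h.
  exists N.+1 => //; move: h; rewrite ltr_pdivlMr// mulrC ltr_pdivrMr ?exprn_gt0//.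
  exact: ltW.
pose f := iter k g.
have cf : continuous f by exact: iter_continuous.
have fy0 : f y0 = y0 by rewrite /f; elim: k {k1 large f cf} => //= k ->.
have loc y := iter_locally_expanding y g1 M0 C0 l1 good (expand k k1) large.
rewrite -(pi1_reprK a); apply/pi1_classP.
apply: (homotopic_iter_trivial cY cPhi iPhi cf _ _ _ fy0).
- by move=> y U; exact: (loc y).1.
- by move=> y; exact: (loc y).2.
- by move=> y; exact: (chart_loops_null_homotopic A y).
(* Level [i * k] of the odometer of [g] is level [i] for [f = g^k]. *)
move=> i; have [c [b e]] := conj (i * k)%N.
have [ze [zeE ze_cl]] := iter_pi1_map (expanding_continuous g_exp) g_y0 (i * k) (repr b).
exists (repr c), (repr b), ze; split; first by move=> t _; rewrite zeE iterM.
apply/pi1_classP; rewrite -!pi1_mul_class -ze_cl !pi1_reprK.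
exact: e.
Qed.
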